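(* Let $n\ge 1$ be an integer, let $E$ be a uniformly convex Banach space whose norm is Fréchet differentiable, and let $\tau$ be a Hausdorff topology on $E$. Let $\{T(p): p\in\mathbb{R}_+^n\}$ be an $n$-parameter $\tau$-continuous semigroup of nonexpansive mappings on a bounded closed convex subset $C$ of $E$. Let $p_1,\dots,p_n\in\mathbb{R}_+^n$ be linearly independent (over $\mathbb{R}$, in the usual sense). Let $\alpha_1,\dots,\alpha_n\in\mathbb{R}$ be such that $\{1,\alpha_1,\dots,\alpha_n\}$ is linearly independent over $\mathbb{Q}$ and $p_0=\alpha_1p_1+\cdots+\alpha_np_n\in\mathbb{R}_+^n$. Let $\lambda_0,\lambda_1,\dots,\lambda_n\in(0,1)$ with $\sum_{j=0}^n\lambda_j=1$. Define a nonexpansive mapping $S$ on $C$ by $$Sx=\sum_{j=0}^n\lambda_jT(p_j)x\qquad(x\in C).$$ Let $x\in C$ and $y_1\in C$, and define sequences $\{x_k\}$ and $\{y_k\}$ in $C$ by $$x_k=\frac{Sx+S^2x+\cdots+S^kx}{k},\qquad y_{k+1}=\tfrac12Sy_k+\tfrac12y_k\qquad(k\in\mathbb{N}).$$ Then each of $\{x_k\}$ and $\{y_k\}$ converges weakly to a common fixed point of $\{T(p): p\in\mathbb{R}_+^n\}$.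
   Context: $\mathbb{N}$ is the set of positive integers and $\mathbb{R}_+^n=[0,\infty)^n$. A family $\{T(p): p\in\mathbb{R}_+^n\}$ of mappings from $C$ into $C$ is an $n$-parameter $\tau$-continuous semigroup of nonexpansive mappings on $C$ if (sg 1) $T(p+q)=T(p)\circ T(q)$ for all $p,q\in\mathbb{R}_+^n$; (sg 2) for each $x\in C$, the map $p\mapsto T(p)x$ from $\mathbb{R}_+^n$ into $C$ is continuous with respect to $\tau$; and (sg 3) each $T(p)$ is nonexpansive, i.e. $\|T(p)x-T(p)y\|\le\|x-y\|$ for all $x,y\in C$. A common fixed point is a $z\in C$ with $T(p)z=z$ for all $p\in\mathbb{R}_+^n$. Real numbers $\{\gamma_1,\dots,\gamma_m\}$ are linearly independent over $\mathbb{Q}$ if there is no nonzero $(\nu_1,\dots,\nu_m)\in\mathbb{Z}^m$ with $\sum_i\nu_i\gamma_i=0$. The norm of $E$ is Fréchet differentiable if for each $x\in E$ with $\|x\|=1$, the limit $\lim_{t\to0}(\|x+ty\|-\|x\|)/t$ exists and is attained uniformly in $y\in E$ with $\|y\|=1$. *)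

(* Defs.v *)
From HB Require Import structures.
From mathcomp Require Import all_boot all_order all_algebra.
From mathcomp Require Import all_classical all_reals all_analysis.

Set Implicit Arguments.
Unset Strict Implicit.
Unset Printing Implicit Defensive.
Import Order.TTheory GRing.Theory Num.Theory.
Import numFieldNormedType.Exports.
Local Open Scope classical_set_scope.
Local Open Scope ring_scope.

Record topology_on (X : Type) := TopologyOn {
  topo_open : set (set X) ;
  topo_openT : topo_open setT ;
  topo_openI : setI_closed topo_open ;
  topo_openU : forall F : set (set X),
    F `<=` topo_open -> topo_open (\bigcup_(A in F) A) }.

(* The type X carrying the topology tau, whatever topology X already has. *)
Definition retopo (X : choiceType) (tau : topology_on X) : Type := X.

HB.instance Definition _ (X : choiceType) (tau : topology_on X) :=
  Choice.copy (retopo tau) X.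

Lemma retopo_openU (X : choiceType) (tau : topology_on X) (I : Type)
    (f : I -> set (retopo tau)) :
  (forall i, topo_open tau (f i)) -> topo_open tau (\bigcup_i f i).
Proof.
move=> fo; suff -> : \bigcup_i f i = \bigcup_(A in range f) A.
  by apply: topo_openU => _ [i _ <-].
by rewrite bigcup_image.
Qed.

HB.instance Definition _ (X : choiceType) (tau : topology_on X) :=
  isOpenTopological.Build (retopo tau)
    (topo_openT tau) (@topo_openI _ tau) (@retopo_openU X tau).

Lemma open_retopo (X : choiceType) (tau : topology_on X) (A : set X) :
  open (A : set (retopo tau)) <-> topo_open tau A.
Proof.
rewrite openE; split=> [Ao|Ao x Ax]; last first.
  by rewrite /interior /nbhs /=; exists A; split.
have -> : A = \bigcup_(B in [set B | topo_open tau B /\ B `<=` A]) B.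
  apply/seteqP; split=> [x /Ao [B [Bo Bx BA]]|x [B [_ BA] /BA]//].
  by exists B.
by apply: topo_openU => B [].
Qed.

Definition nonneg_orthant (R : realType) (n : nat) : set 'rV[R]_n :=
  [set p | forall i, 0 <= p ord0 i].

Definition uniformly_convex (R : realType) (E : normedModType R) : Prop :=
  forall eps : R, 0 < eps -> exists2 delta : R, 0 < delta &
    forall x y : E, `|x| = 1 -> `|y| = 1 -> eps <= `|x - y| ->
      `|2^-1 *: (x + y)| <= 1 - delta.

Definition frechet_differentiable_norm (R : realType) (E : normedModType R)
    : Prop :=
  forall x : E, `|x| = 1 -> exists l : E -> R,
    {uniform [set y : E | `|y| = 1],
      (fun y : E => (`|x + t *: y| - `|x|) / t) @[t --> (0 : R)^'] --> l}.

Definition nonexpansive_on (R : realType) (E : normedModType R) (C : set E)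
    (f : E -> E) : Prop :=
  forall x y, C x -> C y -> `|f x - f y| <= `|x - y|.

(* T is total; only its values at p in the orthant and x in C are constrained.
   T 0 is not required to be the identity. *)
Record nonexpansive_semigroup (R : realType) (E : normedModType R) (n : nat)
    (tau : topology_on E) (C : set E) (T : 'rV[R]_n -> E -> E) : Prop := {
  semigroup_maps : forall p, nonneg_orthant p ->
    forall x, C x -> C (T p x) ;
  semigroupD : forall p q, nonneg_orthant p -> nonneg_orthant q ->
    forall x, C x -> T (p + q) x = T p (T q x) ;
  semigroup_continuous : forall x, C x ->
    {within @nonneg_orthant R n, continuous (fun p => T p x : retopo tau)} ;
  semigroup_nonexpansive : forall p, nonneg_orthant p ->
    nonexpansive_on C (T p) }.

Definition common_fixed_point (R : realType) (E : normedModType R) (n : nat)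
    (C : set E) (T : 'rV[R]_n -> E -> E) (z : E) : Prop :=
  C z /\ forall p, nonneg_orthant p -> T p z = z.

Definition rat_independent (R : realType) (m : nat) (g : m.-tuple R) : Prop :=
  forall nu : 'I_m -> int,
    \sum_(i < m) (nu i)%:~R * tnth g i = 0 -> forall i, nu i = 0.

Definition weakly_cvg (R : realType) (E : normedModType R) (x_ : nat -> E)
    (z : E) : Prop :=
  forall f : {linear E -> R^o}, continuous f -> f (x_ k) @[k --> \oo] --> f z.

(* Main.v *)
(* Bruck's argument. By two-point uniform convexity, a nonexpansive map is almost
   affine on a segment whose length it almost preserves. Hence the asymptotic
   orbits of a nonexpansive S (the sequences a with |S^m (a i) - a (i + m)| -> 0
   uniformly in m) form a convex set, any two of them have a convergent distance,
   and the block means (u i + ... + u (i + n)) / (n + 1) of an orbit u are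
   approximately fixed for n, then i, large. Approximately fixed points
   demicluster at fixed points, again by the two-point estimate. By Frechet
   differentiability of the norm, the derivative of the norm at w1 - w2, with w1
   and w2 fixed, converges along u, so only one fixed point lies in all closed
   convex sets containing a tail of u. The block means (resp. the orbit itself,
   for the averaged map) must accumulate weakly there only, and the Cesaro means
   are averages of block means.
   By strict convexity the fixed points of S are those common to all T (p j), and
   these are fixed by every T q by continuity and Kronecker's theorem: the
   integer combinations of the p j are dense. *)
Require Import Defs.
From mathcomp Require Import all_boot all_order all_algebra.
From mathcomp Require Import all_classical all_reals all_analysis.
From mathcomp Require Import ring lra zify.
Import Order.TTheory GRing.Theory Num.Theory.
Import numFieldNormedType.Exports.
Local Open Scope classical_set_scope.
Local Open Scope ring_scope.

(** * Kronecker's theorem *)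

(** Pigeonhole on fractional parts: [K ^ n + 1] multiples of [alpha] fall into [K ^ n] boxes of side
    [1 / K < eps], and [q] is the difference of two multipliers sharing a box. *)
Lemma dirichlet_approx {R : realType} {n : nat} (alpha : 'I_n -> R) (eps : R) :
  0 < eps -> exists (q : nat) (c : 'I_n -> int),
    (0 < q)%N /\ forall i, `|q%:R * alpha i - (c i)%:~R| < eps.
Proof.
move=> eps0.
pose K := (Num.truncn eps^-1).+1.
have K0 : 0 < K%:R :> R by rewrite ltr0n.
have Keps : K%:R^-1 < eps.
  rewrite invf_plt ?posrE//; apply: truncnS_gt.
pose frac (m : nat) i : R := m%:R * alpha i - (Num.floor (m%:R * alpha i))%:~R.
have frac0 m i : 0 <= frac m i by rewrite subr_ge0 floor_le.
have frac1 m i : frac m i < 1.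
  by rewrite /frac ltrBlDl; have := floorD1_gt (m%:R * alpha i); rewrite intrD.
have trK m i : (Num.truncn (K%:R * frac m i) < K)%N.
  by rewrite truncn_lt_nat ?mulr_ge0 ?ler0n// gtr_pMr.
pose box (m : 'I_(K ^ n).+1) : {ffun 'I_n -> 'I_K} :=
  [ffun i => Ordinal (trK m i)].
have /injectivePn [m1 [m2 m12 eqbox]] : ~~ injectiveb box.
  apply/injectiveP => /leq_card; rewrite card_ffun !card_ord; lia.
wlog lt12 : m1 m2 m12 eqbox / (m1 < m2)%N.
  move=> H; have := m12; rewrite -val_eqE neq_ltn => /orP[] h; first exact: (H m1 m2).
  by apply: (H m2 m1) => //; rewrite eq_sym.
exists (m2 - m1)%N, (fun i => Num.floor (m2%:R * alpha i) - Num.floor (m1%:R * alpha i)).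
split=> [|i]; first by rewrite subn_gt0.
have -> : (m2 - m1)%N%:R * alpha i -
   (Num.floor (m2%:R * alpha i) - Num.floor (m1%:R * alpha i))%:~R
   = frac m2 i - frac m1 i :> R.
  by rewrite /frac natrB ?(ltnW lt12)// rmorphB /=; ring.
apply: le_lt_trans Keps.
have := congr1 (fun f : {ffun 'I_n -> 'I_K} => val (f i)) eqbox; rewrite !ffunE /= => tr12.
have t1 := truncn_itv (mulr_ge0 (ltW K0) (frac0 m1 i)).
have t2 := truncn_itv (mulr_ge0 (ltW K0) (frac0 m2 i)).
rewrite -(ler_pM2l K0) mulfV ?gt_eqF// -[X in X * `|_|](gtr0_norm K0) -normrM.
rewrite mulrBr ler_norml; move: t1 t2; rewrite tr12.
set u1 := K%:R * _; set u2 := K%:R * _; rewrite -natr1.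
by move=> /andP[a1 b1] /andP[a2 b2]; apply/andP; split; lra.
Qed.

(* Estermann's induction on the dimension. *)
Lemma kronecker {R : realType} (n : nat) (alpha beta : 'I_n -> R) (eps : R) :
  (forall (c : int) (nu : 'I_n -> int),
    c%:~R + \sum_i (nu i)%:~R * alpha i = 0 -> forall i, nu i = 0) ->
  0 < eps -> exists (m : int) (c : 'I_n -> int),
    forall i, `|m%:~R * alpha i - (c i)%:~R - beta i| < eps.
Proof.
elim: n alpha beta eps => [|n IH] alpha beta eps indep eps0.
  by exists 0, (fun=> 0) => -[].
have [q [c0 [q0 qc]]] := dirichlet_approx alpha (eps / 2) (divr_gt0 eps0 (ltr0Sn _ _)).
(* The [xi i] are smaller than [eps / 2] and, as the [alpha i] are independent together with 1,
   independent among themselves. *)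
pose xi i := q%:R * alpha i - (c0 i)%:~R.
have xi_indep (nu : 'I_n.+1 -> int) : \sum_i (nu i)%:~R * xi i = 0 -> forall i, nu i = 0.
  move=> h i; suff : q%:Z * nu i = 0.
    by move=> /eqP; rewrite mulf_eq0 => /orP[|/eqP //]; lia.
  apply: (indep (- \sum_i nu i * c0 i) (fun i => q%:Z * nu i)).
  rewrite rmorphN /= rmorph_sum /= -[RHS]h -sumrN -big_split /=.
  by apply: eq_bigr => j _; rewrite /xi !rmorphM /=; ring.
have xi0 : xi ord0 != 0.
  apply/eqP => h; suff /xi_indep /(_ ord0) : \sum_i ((i == ord0)%:R : int)%:~R * xi i = 0 by [].
  rewrite big_ord_recl h mulr0 add0r big1 // => j _.
  by rewrite /= mul0r.
(* After division by [xi ord0] the other [xi i] are independent together with 1. The targets are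
   corrected for the summand [beta ord0] in [t] below. *)
have [|m [c mc]] := IH (fun i => xi (lift ord0 i) / xi ord0)
   (fun i => beta (lift ord0 i) - xi (lift ord0 i) / xi ord0 * beta ord0) (eps / 2)
   _ (divr_gt0 eps0 (ltr0Sn _ _)).
  move=> d nu h i.
  pose nu' j := if unlift ord0 j is Some k then nu k else d.
  have : nu' (lift ord0 i) = 0; last by rewrite /nu' liftK.
  apply: xi_indep; rewrite big_ord_recl /nu' unlift_none.
  under eq_bigr do rewrite liftK.
  have e : xi ord0 * (d%:~R + \sum_j (nu j)%:~R * (xi (lift ord0 j) / xi ord0)) = 0.
    by rewrite h mulr0.
  rewrite -[RHS]e [RHS]mulrDr; congr (_ + _); first by rewrite mulrC.
  by rewrite mulr_sumr; apply: eq_bigr => j _; field.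
(* Modulo integers, the real multiplier [t] hits [beta ord0] exactly and the other targets within
   [eps / 2]; rounding it to the integer [k] costs at most [|xi i|]. *)
pose t := (m%:~R + beta ord0) / xi ord0.
pose k := Num.floor t.
have tk : `|k%:~R - t| <= 1.
  have := floor_itv t; rewrite -/k intrD => /andP[? ?].
  by rewrite ler_norml; apply/andP; split; lra.
pose cc j := if unlift ord0 j is Some i then c i else m.
have tc i : `|t * xi i - (cc i)%:~R - beta i| < eps / 2.
  rewrite /cc; case: unliftP => [j ->|->].
    suff -> : t * xi (lift ord0 j) - (c j)%:~R - beta (lift ord0 j) =
      m%:~R * (xi (lift ord0 j) / xi ord0) - (c j)%:~R -
       (beta (lift ord0 j) - xi (lift ord0 j) / xi ord0 * beta ord0) by [].
    by rewrite /t; field.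
  have -> : t * xi ord0 - m%:~R - beta ord0 = 0 by rewrite /t; field.
  by rewrite normr0; lra.
exists (k * q%:Z), (fun i => k * c0 i + cc i) => i.
have -> : (k * q%:Z)%:~R * alpha i - (k * c0 i + cc i)%:~R - beta i =
    (k%:~R - t) * xi i + (t * xi i - (cc i)%:~R - beta i).
  by rewrite /xi rmorphD !rmorphM /=; ring.
rewrite (le_lt_trans (ler_normD _ _))// (splitr eps) ler_ltD// normrM.
by rewrite (le_trans (ler_wpM2r _ tk))// mul1r; exact: ltW (qc i).
Qed.

(** * Uniform convexity *)

Inductive lterm (R : Type) :=
  | LVar of nat | LZero | LAdd of lterm R & lterm R | LOpp of lterm R
  | LScale of R & lterm R.
Arguments LVar {R}. Arguments LZero {R}. Arguments LAdd {R}.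
Arguments LOpp {R}. Arguments LScale {R}.

Fixpoint leval {R : pzRingType} {V : lmodType R} (env : seq V) (t : lterm R) : V :=
  match t with
  | LVar k => nth 0 env k
  | LZero => 0
  | LAdd a b => leval env a + leval env b
  | LOpp a => - leval env a
  | LScale r a => r *: leval env a
  end.

Fixpoint lcoef {R : pzRingType} (t : lterm R) (i : nat) : R :=
  match t with
  | LVar k => if Nat.eqb i k then 1 else 0
  | LZero => 0
  | LAdd a b => lcoef a i + lcoef b i
  | LOpp a => - lcoef a i
  | LScale r a => r * lcoef a i
  end.

(** A nested conjunction, not a quantified statement: for a concrete list, [cbn] unfolds it and
    [repeat split] leaves one scalar equation per vector. *)
Fixpoint eq_lcoef {R : pzRingType} (n : nat) (s t : lterm R) : Prop :=
  if n is k.+1 then lcoef s k = lcoef t k /\ eq_lcoef k s t else True.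

Lemma leval_coef {R : pzRingType} {V : lmodType R} (env : seq V) (t : lterm R) :
  leval env t = \sum_(i < size env) lcoef t i *: nth 0 env i.
Proof.
elim: t => [k||a IHa b IHb|a IHa|r a IHa] /=; rewrite ?IHa ?IHb.
- have [ke|ke] := ltnP k (size env); last first.
    rewrite nth_default// big1// => i _.
    case: PeanoNat.Nat.eqb_spec => [ik|_]; last by rewrite scale0r.
    by move: ke; rewrite -ik leqNgt ltn_ord.
  rewrite (bigD1 (Ordinal ke))//= PeanoNat.Nat.eqb_refl scale1r big1 ?addr0// => i /eqP ik.
  case: PeanoNat.Nat.eqb_spec => [e|_]; last by rewrite scale0r.
  by case: ik; apply: val_inj.
- by rewrite big1// => i _; rewrite scale0r.
- by rewrite -big_split; apply: eq_bigr => i _; rewrite scalerDl.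
- by rewrite -sumrN; apply: eq_bigr => i _; rewrite scaleNr.
- by rewrite scaler_sumr; apply: eq_bigr => i _; rewrite scalerA.
Qed.

Lemma leval_eq {R : pzRingType} {V : lmodType R} (env : seq V) (s t : lterm R) :
  eq_lcoef (size env) s t -> leval env s = leval env t.
Proof.
move=> st; rewrite !leval_coef; apply: eq_bigr => -[i /= ilt] _.
suff -> : lcoef s i = lcoef t i by [].
elim: (size env) st ilt => // n IH /= [e st]; rewrite ltnS leq_eqVlt => /orP[/eqP->//|].
exact: IH.
Qed.

Ltac lmod_index x env :=
  lazymatch env with
  | cons x _ => constr:(O)
  | cons _ ?e => let n := lmod_index x e in constr:(S n)
  end.

Ltac lmod_reify R env t :=
  lazymatch t with
  | @GRing.add _ ?a ?b =>
      let a' := lmod_reify R env a in let b' := lmod_reify R env b in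
      constr:(@LAdd R a' b')
  | @GRing.opp _ ?a => let a' := lmod_reify R env a in constr:(@LOpp R a')
  | @GRing.scale _ _ ?r ?a => let a' := lmod_reify R env a in constr:(@LScale R r a')
  | @GRing.zero _ => constr:(@LZero R)
  | _ => let n := lmod_index t env in constr:(@LVar R n)
  end.

(* Proves an equality of linear combinations of the vectors listed in env,
   up to equalities between the scalar coefficients. *)
Ltac lmod_eq R env :=
  lazymatch goal with
  | |- ?s = ?t =>
    let s' := lmod_reify R env s in let t' := lmod_reify R env t in
    apply: (@leval_eq _ _ env s' t');
    cbn [size eq_lcoef lcoef Nat.eqb]; repeat split
  end.

(** * Norm estimates from uniform convexity *)

Definition convex_in {R : realType} {E : lmodType R} (K : set E) : Prop :=
  forall (x y : E) (t : R), K x -> K y -> 0 <= t <= 1 ->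
    K (t *: x + (1 - t) *: y).

Lemma ler_norm_sub3 {R : realType} {E : normedModType R} (x y z : E) :
  `|x - z| <= `|x - y| + `|y - z|.
Proof. by rewrite (le_trans _ (ler_normD _ _))// addrA subrK. Qed.

Lemma normr_scale {R : realType} {E : normedModType R} (t : R) (x : E) :
  0 <= t -> `|t *: x| = t * `|x|.
Proof. by move=> t0; rewrite normrZ ger0_norm. Qed.

Lemma normr_unit {R : realType} {E : normedModType R} (x : E) :
  x != 0 -> `| `|x|^-1 *: x | = 1.
Proof.
by move=> x0; rewrite normr_scale ?invr_ge0// mulVf// normr_eq0.
Qed.

Lemma normr_unit_sub {R : realType} {E : normedModType R} (x : E) (r : R) :
  x != 0 -> `|x| <= r -> 
  `| `|x|^-1 *: x - r^-1 *: x| = 1 - `|x| / r.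
Proof.
move=> x0 xr; have nx : 0 < `|x| by rewrite normr_gt0.
have r0 : 0 < r := lt_le_trans nx xr.
rewrite -scalerBl normr_scale; last by rewrite subr_ge0 lef_pV2 ?posrE.
by field; rewrite !gt_eqF.
Qed.

(** For [r <= eps / 2] the triangle inequality suffices. Otherwise [x] and [y] have norm close to
    [r], so [x / r] and [y / r] are close to unit vectors, to which uniform convexity applies; one
    [delta] serves all radii up to [D]. *)
Lemma uniformly_convex_midpoint {R : realType} {E : normedModType R}
    (uc : uniformly_convex E) (D eps : R) :
  0 < eps -> exists2 delta : R, 0 < delta & forall (r : R) (x y : E),
    r <= D -> `|x| <= r -> `|y| <= r -> 2 * (r - delta) <= `|x + y| ->
    `|x - y| <= eps.
Proof.
move=> eps0.
pose D' := Num.max D eps.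
have D'0 : 0 < D' by rewrite lt_max eps0 orbT.
have e0 : 0 < eps / (2 * D') by rewrite divr_gt0// mulr_gt0.
have [d d0 dP] := uc _ e0.
(* The two bounds keep [x / r] within [d / 4] and [eps / (8 * D')] of the normalised [x]; the bound
   [eps / 16] below keeps [x] and [y] away from 0. *)
pose del := Num.min (d * eps / 16) (eps * eps / (32 * D')).
have del0 : 0 < del.
  by rewrite lt_min !divr_gt0 ?mulr_gt0.
exists (Num.min del (eps / 16)) => [|r x y rD xr yr xy].
  by rewrite lt_min del0 divr_gt0.
set del' := Num.min _ _ in xy.
have del'1 : del' <= d * eps / 16 by rewrite /del' /del !ge_min lexx.
have del'2 : del' <= eps * eps / (32 * D') by rewrite /del' /del !ge_min lexx orbT.
have del'3 : del' <= eps / 16 by rewrite /del' !ge_min lexx orbT.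
have [rs|rb] := lerP r (eps / 2).
  by rewrite (le_trans (ler_normB _ _))//; lra.
have r0 : 0 < r by lra.
have r0' := ltW r0.
have xyD := ler_normD x y.
have xl : r - 2 * del' <= `|x| by lra.
have yl : r - 2 * del' <= `|y| by lra.
have x0 : x != 0 by rewrite -normr_gt0; lra.
have y0 : y != 0 by rewrite -normr_gt0; lra.
have rinv : r^-1 <= 2 / eps.
  by rewrite -[leRHS]invf_div lef_pV2 ?posrE//; [lra | rewrite divr_gt0].
have lr (z : E) : r - 2 * del' <= `|z| -> z != 0 -> `|z| <= r ->
    `| `|z|^-1 *: z - r^-1 *: z | <= Num.min (d / 4) (eps / (8 * D')).
  move=> zl z0 zr; rewrite normr_unit_sub//.
  have -> : 1 - `|z| / r = (r - `|z|) / r by field; rewrite gt_eqF.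
  have h : (r - `|z|) / r <= (2 * del') * (2 / eps).
    by rewrite ler_pM ?subr_ge0 ?invr_ge0 ?(ltW r0)//; lra.
  rewrite (le_trans h)// le_min; apply/andP; split.
    have -> : d / 4 = 2 * (d * eps / 16) * (2 / eps) by field; rewrite gt_eqF.
    by apply: ler_wpM2r; [rewrite divr_ge0 // ltW | rewrite ler_pM2l].
  have -> : eps / (8 * D') = 2 * (eps * eps / (32 * D')) * (2 / eps).
    by field; rewrite !gt_eqF.
  by apply: ler_wpM2r; [rewrite divr_ge0 // ltW | rewrite ler_pM2l].
have lrx := lr x xl x0 xr.
have lry := lr y yl y0 yr.
set x' := `|x|^-1 *: x in lrx; set y' := `|y|^-1 *: y in lry.
have nx' : `|x'| = 1 by exact: normr_unit.
have ny' : `|y'| = 1 by exact: normr_unit.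
have mid : 1 - d < `|2^-1 *: (x' + y')|.
  rewrite normr_scale ?invr_ge0 ?ler0n//.
  have xy' : r^-1 * `|x + y| <= `|x' + y'| + d / 2.
    rewrite -normr_scale ?invr_ge0//.
    have -> : r^-1 *: (x + y) = (x' + y') - (x' - r^-1 *: x) - (y' - r^-1 *: y).
      by lmod_eq R [:: x; y; x'; y']; ring.
    have := ler_normB (x' + y' - (x' - r^-1 *: x)) (y' - r^-1 *: y).
    have := ler_normB (x' + y') (x' - r^-1 *: x).
    move: lrx lry; rewrite !le_min => /andP[? _] /andP[? _]; lra.
  have : r^-1 * (2 * (r - del')) <= r^-1 * `|x + y| by rewrite ler_pM2l ?invr_gt0.
  have -> : r^-1 * (2 * (r - del')) = 2 - 2 * del' * r^-1 by field; rewrite gt_eqF.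
  have : 2 * del' * r^-1 <= (2 * (d * eps / 16)) * (2 / eps).
    rewrite ler_pM ?invr_ge0 ?(ltW r0)//; last by lra.
    by rewrite mulr_ge0 ?ler0n // /del' le_min ltW// divr_ge0 ?ler0n// ltW.
  have -> : (2 * (d * eps / 16)) * (2 / eps) = d / 4 by field; rewrite gt_eqF.
  lra.
have xy'e : `|x' - y'| < eps / (2 * D').
  rewrite ltNge; apply/negP => h; have := dP x' y' nx' ny' h; lra.
have -> : x - y = r *: ((x' - y') - (x' - r^-1 *: x) + (y' - r^-1 *: y)).
  have -> : (x' - y') - (x' - r^-1 *: x) + (y' - r^-1 *: y) = r^-1 *: (x - y).
    by lmod_eq R [:: x; y; x'; y']; ring.
  by rewrite scalerA mulfV ?gt_eqF// scale1r.
rewrite normr_scale//.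
have h : `|(x' - y') - (x' - r^-1 *: x) + (y' - r^-1 *: y)| <= eps / D'.
  have := ler_normD ((x' - y') - (x' - r^-1 *: x)) (y' - r^-1 *: y).
  have := ler_normB (x' - y') (x' - r^-1 *: x).
  move: lrx lry; rewrite !le_min => /andP[_ ?] /andP[_ ?].
  have -> : eps / D' = eps / (2 * D') + 4 * (eps / (8 * D')) by field; rewrite gt_eqF.
  lra.
apply: le_trans (_ : D' * (eps / D') <= _).
  by rewrite ler_pM// ?(ltW r0)// le_max rD.
by rewrite mulrCA mulfV ?mulr1 ?gt_eqF.
Qed.

(** For [t <= 1 / 2], [t x + (1 - t) y = t (x + y) + (1 - 2 t) y] reduces the claim to midpoints.
    The factor [t * (1 - t)] makes [delta] independent of [t]: for small [t] it gives the bound by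
    itself. *)
Lemma uniformly_convex_weighted {R : realType} {E : normedModType R}
    (uc : uniformly_convex E) (D eps : R) :
  0 < eps -> exists2 delta : R, 0 < delta & forall (r t : R) (x y : E),
    0 <= t <= 1 -> r <= D -> `|x| <= r -> `|y| <= r ->
    r - delta <= `|t *: x + (1 - t) *: y| ->
    t * (1 - t) * `|x - y| <= eps.
Proof.
move=> eps0.
have [d d0 dP] := uniformly_convex_midpoint uc D eps eps0.
pose D' := Num.max D 1.
have D'0 : 0 < D' by rewrite lt_max ltr01 orbT.
have D'D : D <= D' by rewrite le_max lexx.
(* In the nontrivial case [eps / D' < 2 * t], so this constant is at most [2 * t * d], the loss
   allowed in [t * |x + y|]. *)
exists (d * (eps / D')) => [|r t x y t01 rD xr yr xy].
  by rewrite mulr_gt0 ?divr_gt0.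
wlog th : t x y t01 xr yr xy / t <= 2^-1.
  move=> H; have [|th] := lerP t 2^-1; first exact: H.
  have -> : t * (1 - t) * `|x - y| = (1 - t) * (1 - (1 - t)) * `|y - x|.
    by rewrite distrC; ring.
  apply: H => //; [lra| |lra].
  by have -> : (1 - t) *: y + (1 - (1 - t)) *: x = t *: x + (1 - t) *: y
     by lmod_eq R [:: x; y]; ring.
have xyr : `|x - y| <= 2 * r by rewrite (le_trans (ler_normB _ _))//; lra.
have [t0 t1] : 0 <= t /\ t <= 1 by lra.
have xy0 := normr_ge0 (x - y).
have r0 : 0 <= r := le_trans (normr_ge0 x) xr.
have [ts|tb] := lerP (2 * t * D') eps.
  apply: le_trans ts; apply: le_trans (_ : (t * 1) * (2 * D') <= _).
    by rewrite ler_pM ?mulr_ge0// ?ler_wpM2l//; lra.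
  by rewrite mulr1 mulrA [2 * t]mulrC.
have mid : 2 * (r - d) <= `|x + y|.
  have : `|t *: x + (1 - t) *: y| <= t * `|x + y| + (1 - 2 * t) * r.
    have -> : t *: x + (1 - t) *: y = t *: (x + y) + (1 - 2 * t) *: y.
      by lmod_eq R [:: x; y]; ring.
    rewrite (le_trans (ler_normD _ _))// !normr_scale//; last lra.
    by rewrite lerD2l ler_wpM2l//; lra.
  have tp : 0 < t by rewrite -(pmulr_rgt0 _ (ltr0Sn R 1)) -(pmulr_lgt0 _ D'0); lra.
  have : d * (eps / D') <= d * (2 * t).
    by rewrite ler_pM2l// ler_pdivrMr// ltW.
  move=> h1 h2; rewrite -(ler_pM2l tp); lra.
apply: le_trans (dP r x y rD xr yr mid).
apply: ler_piMl => //.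
by rewrite -[leRHS]mulr1 ler_pM//; lra.
Qed.

(* With [z := t x + (1 - t) y], apply weighted uniform convexity to
   [(f x - f z) / (1 - t)] and [(f z - f y) / t], both of norm at most [|x - y|]. *)
Lemma nonexpansive_almost_affine {R : realType} {E : normedModType R}
    (uc : uniformly_convex E) (D eps : R) :
  0 < eps -> exists2 delta : R, 0 < delta &
    forall (C : set E) (f : E -> E) (x y : E) (t : R),
    convex_in C -> nonexpansive_on C f -> C x -> C y -> 0 <= t <= 1 ->
    `|x - y| <= D -> `|x - y| - delta <= `|f x - f y| ->
    `|f (t *: x + (1 - t) *: y) - (t *: f x + (1 - t) *: f y)| <= eps.
Proof.
move=> eps0; have [d d0 dP] := uniformly_convex_weighted uc D eps eps0.
exists d => // C f x y t cC nf Cx Cy t01 xyD fxy.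
set z := t *: x + (1 - t) *: y.
have Cz : C z by exact: cC.
have [te|t0] := eqVneq t 0.
  have -> : z = y by rewrite /z te; lmod_eq R [:: x; y]; ring.
  have -> : t *: f x + (1 - t) *: f y = f y by rewrite te; lmod_eq R [:: f x; f y]; ring.
  by rewrite subrr normr0 ltW.
have [te|t1] := eqVneq (1 - t) 0.
  have te' : t = 1 by lra.
  have -> : z = x by rewrite /z te'; lmod_eq R [:: x; y]; ring.
  have -> : t *: f x + (1 - t) *: f y = f x by rewrite te'; lmod_eq R [:: f x; f y]; ring.
  by rewrite subrr normr0 ltW.
have tp : 0 < t by rewrite lt_neqAle eq_sym t0; lra.
have tp1 : 0 < 1 - t by rewrite lt_neqAle eq_sym t1; lra.
have tp' := ltW tp; have tp1' := ltW tp1.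
have xz : `|(1 - t)^-1 *: (f x - f z)| <= `|x - y|.
  rewrite normr_scale ?invr_ge0// ler_pdivrMl//.
  apply: le_trans (nf _ _ Cx Cz) _.
  have -> : x - z = (1 - t) *: (x - y) by rewrite /z; lmod_eq R [:: x; y]; ring.
  by rewrite normr_scale.
have zy : `|t^-1 *: (f z - f y)| <= `|x - y|.
  rewrite normr_scale ?invr_ge0// ler_pdivrMl//.
  apply: le_trans (nf _ _ Cz Cy) _.
  have -> : z - y = t *: (x - y) by rewrite /z; lmod_eq R [:: x; y]; ring.
  by rewrite normr_scale.
have := dP `|x - y| (1 - t) _ _ _ xyD xz zy.
(* With weight [1 - t] the two vectors combine to [f x - f y]; their difference times [t * (1 - t)]
   is the defect to be bounded. *)
have -> : (1 - t) *: ((1 - t)^-1 *: (f x - f z)) + (1 - (1 - t)) *: (t^-1 *: (f z - f y))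
    = f x - f y.
  by lmod_eq R [:: f x; f y; f z]; field; rewrite ?t0 ?t1.
move=> /(_ _ fxy) h; apply: le_trans (h _); last by lra.
rewrite -normr_scale; last by rewrite mulr_ge0//; lra.
rewrite distrC.
suff -> : t *: f x + (1 - t) *: f y - f z = ((1 - t) * (1 - (1 - t))) *:
    ((1 - t)^-1 *: (f x - f z) - t^-1 *: (f z - f y)) by [].
by lmod_eq R [:: f x; f y; f z]; field; rewrite ?t0 ?t1.
Qed.

(** If both ends are almost fixed, [f] almost preserves their distance, hence is almost affine on
    the segment, where the displacement is then close to a combination of those at the ends. *)
Lemma approx_fixed_segment {R : realType} {E : normedModType R}
    (uc : uniformly_convex E) (D eps : R) :
  0 < eps -> exists2 delta : R, 0 < delta &
    forall (C : set E) (f : E -> E) (x y : E) (t : R),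
    convex_in C -> nonexpansive_on C f -> C x -> C y -> 0 <= t <= 1 ->
    `|x - y| <= D -> `|x - f x| <= delta -> `|y - f y| <= delta ->
    `|(t *: x + (1 - t) *: y) - f (t *: x + (1 - t) *: y)| <= eps.
Proof.
move=> eps0; have e20 : 0 < eps / 2 by lra.
have [d d0 dP] := nonexpansive_almost_affine uc D (eps / 2) e20.
exists (Num.min (d / 2) (eps / 2)) => [|C f x y t cC nf Cx Cy t01 xyD].
  by rewrite lt_min e20 andbT divr_gt0.
rewrite !le_min => /andP[xf1 xf2] /andP[yf1 yf2].
have h : `|x - y| - d <= `|f x - f y|.
  have := ler_norm_sub3 x (f x) y; have := ler_norm_sub3 (f x) (f y) y.
  by rewrite (distrC (f y)); lra.
have := dP C f x y t cC nf Cx Cy t01 xyD h.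
set z := t *: x + (1 - t) *: y; set w := t *: f x + (1 - t) *: f y => zw.
rewrite (le_trans (ler_norm_sub3 _ w _))// (distrC w).
have : `|z - w| <= eps / 2.
  have -> : z - w = t *: (x - f x) + (1 - t) *: (y - f y).
    by rewrite /z /w; lmod_eq R [:: x; y; f x; f y]; ring.
  rewrite (le_trans (ler_normD _ _))// !normr_scale//; try lra.
  have : t * `|x - f x| <= t * (eps / 2) by rewrite ler_wpM2l//; lra.
  have : (1 - t) * `|y - f y| <= (1 - t) * (eps / 2) by rewrite ler_wpM2l//; lra.
  lra.
lra.
Qed.

Lemma closed_limit {R : realType} {E : normedModType R} (K : set E) (w : E) :
  closed K -> (forall eps : R, 0 < eps -> exists2 y, K y & `|w - y| < eps) -> K w.
Proof.
move=> cK h; rewrite (closure_id K).1//.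
move=> B /nbhs_ballP[e /= e0 eB]; have [y Ky wy] := h e e0.
by exists y; split => //; apply: eB; rewrite -ball_normE.
Qed.

Lemma cauchy_seq_limit {R : realType} {E : completeNormedModType R} (u : nat -> E) :
  (forall eps : R, 0 < eps -> exists N, forall i j,
      (N <= i)%N -> (N <= j)%N -> `|u i - u j| <= eps) ->
  exists w, forall eps : R, 0 < eps -> exists N, forall i, (N <= i)%N -> `|w - u i| <= eps.
Proof.
move=> h; have /cvg_ex[w uw] : cvg (u @ \oo).
  apply: cauchy_cvg; apply: cauchy_exP => e e0.
  have [N NP] := h (e / 2) (divr_gt0 e0 (ltr0Sn _ _)).
  exists (u N); exists N => // i /= Ni; rewrite -ball_normE /=.
  by rewrite (le_lt_trans (NP N i _ _))//; lra.
exists w => e e0; move/cvgrPdist_le : uw => /(_ e e0) [N _ NP].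
by exists N.
Qed.

(** This stands in for weak compactness. Let [L] be the supremum over [j] of the infimum of the norm
    on [K j]. Points [u j] of norm at most [L + 1 / (j + 1)] form a Cauchy sequence, as their
    midpoints stay in some [K N1] where the norm is at least nearly [L]. *)
Lemma uniformly_convex_bigcap {R : realType} {E : completeNormedModType R}
    (uc : uniformly_convex E) (K : nat -> set E) (D : R) :
  (forall j, convex_in (K j)) -> (forall j, closed (K j)) ->
  (forall j, K j !=set0) -> (forall i j, (i <= j)%N -> K j `<=` K i) ->
  (forall x, K 0%N x -> `|x| <= D) ->
  exists w, forall j, K j w.
Proof.
move=> cK clK neK decK bK.
pose A := [set s : R | exists j, forall x, K j x -> s <= `|x|].
have supA : has_sup A.
  split; first by exists 0, 0%N => x _.
  exists D => s [j sj]; have [x Kx] := neK j.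
  by rewrite (le_trans (sj x Kx))// bK//; apply: decK Kx.
set L := sup A.
have LD : L <= D.
  apply: sup_le_ub => [|r [j rj]]; first exact: supA.1.
  by have [x Kx] := neK j; rewrite (le_trans (rj x Kx))// bK//; apply: decK Kx.
have pick j : exists x, K j x /\ `|x| <= L + j.+1%:R^-1.
  apply: contrapT => h.
  have : A (L + j.+1%:R^-1).
    exists j => x Kx; rewrite leNgt; apply/negP => lt; apply: h.
    by exists x; split => //; exact: ltW.
  move=> /(sup_upper_bound supA); rewrite -/L gerDl leNgt => /negP; apply.
  by rewrite invr_gt0 ltr0n.
have [u uP] := choice pick.
have [e e0|w wP] := @cauchy_seq_limit R E u.
  have [d d0 dP] := uniformly_convex_midpoint uc (D + 1) e e0.
  have [s [N1 N1P] sL] := sup_adherent (divr_gt0 d0 (ltr0Sn R 1)) supA.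
  pose N := maxn N1 (Num.truncn (d / 2)^-1).
  have Nd : N.+1%:R^-1 <= d / 2.
    rewrite invf_ple ?posrE ?divr_gt0 ?ltr0Sn// ltW// (lt_le_trans (truncnS_gt _))//.
    by rewrite ler_nat ltnS leq_maxr.
  exists N => i j Ni Nj.
  have bnd k : (N <= k)%N -> `|u k| <= L + N.+1%:R^-1.
    move=> Nk; rewrite (le_trans (uP k).2)// lerD2l lef_pV2 ?posrE ?ltr0n//.
    by rewrite ler_nat ltnS.
  apply: (dP (L + N.+1%:R^-1)) => //; [|exact: bnd|exact: bnd|].
    by rewrite lerD// invf_le1// ler1n.
  have KN k : (N <= k)%N -> K N1 (u k).
    by move=> Nk; apply: decK (uP k).1; apply: leq_trans Nk; rewrite leq_maxl.
  have /N1P : K N1 (2^-1 *: u i + (1 - 2^-1) *: u j) by apply: cK; [exact: KN|exact: KN|lra].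
  have -> : 2^-1 *: u i + (1 - 2^-1) *: u j = 2^-1 *: (u i + u j).
    by lmod_eq R [:: u i; u j]; field.
  rewrite normr_scale ?invr_ge0 ?ler0n//; rewrite -/L in sL.
  by move: Nd; set v := _.+1%:R^-1 => ? ?; lra.
exists w => j; apply: closed_limit => // e e0.
have [N NP] := wP (e / 2) (divr_gt0 e0 (ltr0Sn _ _)).
exists (u (maxn N j)).
  by apply: decK (uP _).1; rewrite leq_maxr.
by rewrite (le_lt_trans (NP _ _)) ?leq_maxl//; lra.
Qed.

(** * Demiclosedness *)

(** Generated by segments instead of finite weighted sums, so that inclusions in convex sets follow
    by plain induction. *)
Inductive hull {R : realType} {E : lmodType R} (A : set E) : E -> Prop :=
  | hull_base x : A x -> hull A x
  | hull_segment x y (t : R) : hull A x -> hull A y -> 0 <= t <= 1 ->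
      hull A (t *: x + (1 - t) *: y).
Arguments hull_segment {R E A x y} t.

Lemma hull_sub {R : realType} {E : lmodType R} (A K : set E) :
  convex_in K -> A `<=` K -> hull A `<=` K.
Proof. by move=> cK AK x; elim=> // ? ? t *; apply: cK. Qed.

Lemma hull_mono {R : realType} {E : lmodType R} (A B : set E) :
  A `<=` B -> hull A `<=` hull B.
Proof.
move=> AB; apply: hull_sub => [x y t|x /AB]; [exact: hull_segment|exact: hull_base].
Qed.

(** Collecting the weights on [K] into a total [q] and dividing by it brings a combination of two
    such points to the same shape. When [q] is 0 the combination is [a] itself. *)
Lemma segment_hull_convex {R : realType} {E : lmodType R} (a : E) (K : set E) :
  convex_in K ->
  convex_in [set z | exists y (t : R), [/\ K y, 0 <= t <= 1 & z = t *: a + (1 - t) *: y]].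
Proof.
move=> cK _ _ s [x [t [Kx t01 ->]]] [y [r [Ky r01 ->]]] s01.
have [q0|q0] := eqVneq (s * (1 - t) + (1 - s) * (1 - r)) 0.
  exists x, 1; split=> //; first by rewrite ler01 lexx.
  have p1 : 0 <= s * (1 - t) by rewrite mulr_ge0//; lra.
  have p2 : 0 <= (1 - s) * (1 - r) by rewrite mulr_ge0//; lra.
  have e1 : s * (1 - t) = 0 by lra.
  have e2 : (1 - s) * (1 - r) = 0 by lra.
  rewrite !scalerDr !scalerA e1 e2; lmod_eq R [:: a; x; y]; lra.
set q := (X in X != 0) in q0.
have p1 : 0 <= s * (1 - t) by rewrite mulr_ge0//; lra.
have p2 : 0 <= (1 - s) * (1 - r) by rewrite mulr_ge0//; lra.
have qp : 0 < q by rewrite lt_neqAle eq_sym q0 addr_ge0.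
exists ((s * (1 - t) / q) *: x + (1 - s * (1 - t) / q) *: y), (s * t + (1 - s) * r).
split.
- apply: cK => //; rewrite divr_ge0 ?(ltW qp)//= ler_pdivrMr// mul1r /q; lra.
- have ? : 0 <= s * t by rewrite mulr_ge0//; lra.
  have ? : 0 <= (1 - s) * r by rewrite mulr_ge0//; lra.
  by apply/andP; split; [lra|]; rewrite /q in qp; lra.
- by lmod_eq R [:: a; x; y]; rewrite /q; field; rewrite -/q.
Qed.

Lemma convex_closure {R : realType} {E : normedModType R} (K : set E) :
  convex_in K -> convex_in (closure K).
Proof.
have clP (x : E) : closure K x -> forall e : R, 0 < e -> exists2 y, K y & `|x - y| < e.
  move=> cx e e0; have [y [Ky xy]] := cx _ (nbhsx_ballx x e e0).
  by exists y => //; move: xy; rewrite -ball_normE.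
move=> cK x y t /clP Kx /clP Ky t01 B /nbhs_ballP[e /= e0 eB].
have [x' Kx' xx'] := Kx e e0; have [y' Ky' yy'] := Ky e e0.
exists (t *: x' + (1 - t) *: y'); split; first exact: cK.
apply: eB; rewrite -ball_normE /=.
have -> : t *: x + (1 - t) *: y - (t *: x' + (1 - t) *: y') =
   t *: (x - x') + (1 - t) *: (y - y') by lmod_eq R [:: x; y; x'; y']; ring.
rewrite (le_lt_trans (ler_normD _ _))// !normr_scale; try lra.
have : t * `|x - x'| <= t * Num.max `|x - x'| `|y - y'|.
  by rewrite ler_wpM2l ?le_max ?lexx//; lra.
have : (1 - t) * `|y - y'| <= (1 - t) * Num.max `|x - x'| `|y - y'|.
  by rewrite ler_wpM2l ?le_max ?lexx ?orbT//; lra.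
have : Num.max `|x - x'| `|y - y'| < e by rewrite gt_max xx'.
lra.
Qed.

(** Closed convex sets containing a tail of [v] replace weak cluster points. Along a subsequence
    with fast decreasing displacements, the convex hulls of tails consist of almost fixed points,
    and their closures share a point. *)
Lemma demiclosed_cluster {R : realType} {E : completeNormedModType R}
    (uc : uniformly_convex E) (C : set E) (f : E -> E) (D : R) (v : nat -> E) :
  closed C -> convex_in C -> (forall x, C x -> `|x| <= D) ->
  nonexpansive_on C f -> (forall i, C (v i)) ->
  (forall eps : R, 0 < eps -> exists N, forall i, (N <= i)%N -> `|v i - f (v i)| <= eps) ->
  exists w, [/\ C w, f w = w & forall K : set E, convex_in K -> closed K ->
    (exists N, forall i, (N <= i)%N -> K (v i)) -> K w].
Proof.
move=> clC cC bC nf Cv vf.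
(* Positivity of [e] is assumed after the existential, so that [choice] yields a total function
   [g]. *)
have phi (e : R) : exists d : R, 0 < e -> 0 < d /\
    forall (x y : E) (t : R), C x -> C y -> 0 <= t <= 1 -> `|x - f x| <= d -> `|y - f y| <= d ->
    `|(t *: x + (1 - t) *: y) - f (t *: x + (1 - t) *: y)| <= e.
  have [e0|] := ltP 0 e; last by move=> _; exists 0.
  have [d d0 dP] := approx_fixed_segment uc (2 * D) e e0.
  exists d => _; split=> // x y t Cx Cy t01 xf yf.
  apply: (dP C) => //; rewrite (le_trans (ler_normB _ _))//.
  by have := bC x Cx; have := bC y Cy; lra.
have [g gP] := choice phi.
(* A segment whose ends are displaced by at most [del j.+1] is displaced by at most [del j]; halving
   makes [del] tend to 0. *)
pose del := fix del j : R := if j is k.+1 then Num.min (g (del k)) (del k / 2) else 1.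
have del0 j : 0 < del j.
  elim: j => [|j IH] /=; first exact: ltr01.
  by rewrite lt_min (gP _ IH).1 divr_gt0.
have delS j : del j.+1 <= g (del j) by rewrite /= ge_min lexx.
have delS2 j : del j.+1 <= del j / 2 by rewrite /= ge_min lexx orbT.
have del_small (e : R) : 0 < e -> exists j, del j <= e.
  move=> e0.
  have h j : del j <= j.+1%:R^-1.
    elim: j => [|j IH]; first by rewrite invr1.
    rewrite (le_trans (delS2 _))// ler_pdivrMr// (le_trans IH)//.
    rewrite [leRHS]mulrC -ler_pdivrMl// -invfM lef_pV2 ?posrE ?mulr_gt0 ?ltr0n//.
    by rewrite -natrM ler_nat; lia.
  exists (Num.truncn e^-1); rewrite (le_trans (h _))// invf_ple ?posrE ?ltr0n//.
  exact/ltW/truncnS_gt.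
have [N NP] := choice (fun j => vf (del j) (del0 j)).
(* [N j] controls the displacement; the maximum with [j] keeps tails of [u] inside tails of [v]. The
   shift in [u] makes [u j] displaced by at most [del j.+1]. *)
pose k j := maxn (N j) j.
pose u j := v (k j.+1).
pose A j m := [set z | exists i, (j <= i < m)%N /\ z = u i].
pose H j := [set z | exists m, hull (A j m) z].
have hullC j m x : hull (A j m) x -> C x.
  by apply: hull_sub => // _ [i [_ ->]]; exact: Cv.
(* Peeling off [u j] lets [hull_fix] spend one level of [del] per point, by induction on [m - j]. *)
have hull_cons j m x : hull (A j m) x -> x = u j \/
    exists y (t : R), [/\ hull (A j.+1 m) y, 0 <= t <= 1 & x = t *: u j + (1 - t) *: y].
  have [ne|e] := pselect (exists y, hull (A j.+1 m) y).
    move=> hx; right; move: x hx; apply: hull_sub.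
      by apply: segment_hull_convex => x y t; exact: hull_segment.
    move=> _ [i [/andP[ji im] ->]]; move: ji; rewrite leq_eqVlt => /orP[/eqP <-|ji].
      have [y hy] := ne; exists y, 1; split; [by []|by rewrite ler01 lexx|].
      by lmod_eq R [:: u j; y]; ring.
    exists (u i), 0; split; [|by rewrite lexx ler01|by lmod_eq R [:: u i; u j]; ring].
    by apply: hull_base; exists i; rewrite ji im.
  move=> hx; left; move: x hx; apply: (@hull_sub _ _ _ [set u j]).
    by move=> _ _ t -> -> _ /=; lmod_eq R [:: u j]; ring.
  move=> _ [i [/andP[ji im] ->]]; move: ji; rewrite leq_eqVlt => /orP[/eqP ->//|ji].
  by case: e; exists (u i); apply: hull_base; exists i; rewrite ji im.
have uf j : `|u j - f (u j)| <= del j.+1 by apply: NP; rewrite leq_maxl.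
have Cu j : C (u j) by exact: Cv.
have hull_fix d j m x : (m - j <= d)%N -> hull (A j m) x -> `|x - f x| <= del j.
  elim: d j x => [|d IH] j x mj.
    suff e : hull (A j m) `<=` set0 by move=> /e.
    by apply: hull_sub => [? ? ? []|z [i [/andP[? ?] _]]]; lia.
  have jj : del j.+1 <= del j by rewrite (le_trans (delS2 _))//; have := del0 j; lra.
  move=> /hull_cons[->|[y [t [hy t01 ->]]]]; first exact: le_trans (uf _) jj.
  apply: (gP _ (del0 j)).2 => //; first exact: hullC hy.
    exact: le_trans (uf _) (delS _).
  by rewrite (le_trans _ (delS j))// IH//; lia.
have HA j m m' : (m <= m')%N -> hull (A j m) `<=` hull (A j m').
  by move=> mm; apply: hull_mono => _ [i [/andP[ji im] ->]]; exists i; rewrite ji (leq_trans im).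
have cH j : convex_in (H j).
  move=> x y t [m hx] [m' hy] t01; exists (maxn m m').
  by apply: hull_segment => //; [apply: HA hx; rewrite leq_maxl|apply: HA hy; rewrite leq_maxr].
have HC j : closure (H j) `<=` C.
  rewrite (closure_id C).1//; apply: closureS => x [m]; exact: hullC.
have [|||||w wP] := @uniformly_convex_bigcap R E uc (fun j => closure (H j)) D.
- by move=> j; exact: convex_closure.
- by move=> j; exact: closed_closure.
- move=> j; exists (u j); apply: subset_closure; exists j.+1; apply: hull_base.
  by exists j; rewrite leqnn ltnSn.
- move=> i j ij; apply: closureS => x [m hx]; exists m; apply: hull_mono hx.
  by move=> _ [l [/andP[jl lm] ->]]; exists l; rewrite (leq_trans ij).
- by move=> x /HC; exact: bC.
have Cw : C w := HC 0%N w (wP 0%N).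
exists w; split=> //.
  apply/eqP; rewrite -subr_eq0 -normr_le0; apply/ler_addgt0Pl => e e0; rewrite addr0.
  have [j je] := del_small (e / 3) (divr_gt0 e0 (ltr0Sn _ _)).
  have [y [[m hy] yw]] := wP j _ (nbhsx_ballx w (e / 3) (divr_gt0 e0 (ltr0Sn _ _))).
  have yf := hull_fix _ _ _ _ (leqnn _) hy.
  have yw' : `|w - y| < e / 3 by move: yw; rewrite -ball_normE.
  have := nf _ _ Cw (hullC _ _ _ hy).
  have := ler_norm_sub3 (f w) (f y) w; have := ler_norm_sub3 (f y) y w.
  by rewrite (distrC (f y) y) (distrC y w); lra.
move=> K cK clK [M MP]; rewrite (closure_id K).1//.
apply: closureS (wP M) => x [m]; apply: hull_sub => // _ [i [/andP[Mi _] ->]].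
by apply: MP; rewrite (leq_trans Mi)// (leq_trans (leqnSn i))// leq_maxr.
Qed.

(** * Asymptotic orbits *)

(* Unlike for mere orbits, this property passes to convex combinations. *)
Definition asymptotic_orbit {R : realType} {E : normedModType R} (C : set E)
    (f : E -> E) (a : nat -> E) : Prop :=
  (forall i, C (a i)) /\
  forall eps : R, 0 < eps -> exists N, forall i m, (N <= i)%N ->
    `|iter m f (a i) - a (i + m)%N| <= eps.

Section NonexpansiveOrbits.
Context {R : realType} {E : completeNormedModType R} (C : set E) (f : E -> E).
Hypotheses (fC : forall x, C x -> C (f x)) (nf : nonexpansive_on C f).

Lemma iter_in m x : C x -> C (iter m f x).
Proof. by move=> Cx; elim: m => //= m; exact: fC. Qed.

Lemma iter_nonexpansive m : nonexpansive_on C (iter m f).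
Proof.
elim: m => [|m IH] x y Cx Cy //=.
by rewrite (le_trans (nf _ _ (iter_in _ _ Cx) (iter_in _ _ Cy)))// IH.
Qed.

Lemma asymptotic_orbit_iter x : C x -> asymptotic_orbit C f (fun i => iter i f x).
Proof.
move=> Cx; split=> [i|e e0]; first exact: iter_in.
by exists 0%N => i m _; rewrite addnC iterD subrr normr0 ltW.
Qed.

Lemma asymptotic_orbit_fixed z : C z -> f z = z -> asymptotic_orbit C f (fun=> z).
Proof.
move=> Cz fz; split=> // e e0; exists 0%N => i m _.
have -> : iter m f z = z by elim: m => //= m ->.
by rewrite subrr normr0 ltW.
Qed.

Lemma asymptotic_orbit_shift (a : nat -> E) n :
  asymptotic_orbit C f a -> asymptotic_orbit C f (fun i => a (i + n)%N).
Proof.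
move=> [Ca oa]; split=> // e /oa[N NP]; exists N => i m Ni.
by rewrite addnAC NP// (leq_trans Ni)// leq_addr.
Qed.

(** The distances are nonincreasing up to arbitrarily small errors, so they converge to the infimum
    of their eventual upper bounds. *)
Lemma asymptotic_orbit_dist (a b : nat -> E) :
  asymptotic_orbit C f a -> asymptotic_orbit C f b ->
  exists l : R, forall eps : R, 0 < eps -> exists N, forall i, (N <= i)%N ->
    `| `|a i - b i| - l| <= eps.
Proof.
move=> [Ca oa] [Cb ob].
pose A := [set s : R | exists N, forall i, (N <= i)%N -> `|a i - b i| <= s].
have almost_dec (e : R) : 0 < e -> exists N, forall i m, (N <= i)%N ->
    `|a (i + m)%N - b (i + m)%N| <= `|a i - b i| + e.
  move=> e0; have e2 : 0 < e / 2 by lra.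
  have [Na aP] := oa _ e2; have [Nb bP] := ob _ e2.
  exists (maxn Na Nb) => i m; rewrite geq_max => /andP[ia ib].
  have := ler_norm_sub3 (a (i + m)%N) (iter m f (a i)) (b (i + m)%N).
  have := ler_norm_sub3 (iter m f (a i)) (iter m f (b i)) (b (i + m)%N).
  rewrite (distrC (a (i + m)%N) (iter m f (a i))); have := aP i m ia; have := bP i m ib.
  have := iter_nonexpansive m _ _ (Ca i) (Cb i); lra.
have [N1 N1P] := almost_dec 1 ltr01.
have infA : has_inf A.
  split; last by exists 0 => s [N NP]; exact: le_trans (NP N (leqnn _)).
  exists (`|a N1 - b N1| + 1), N1 => i ij.
  by rewrite -(subnKC ij) N1P.
exists (inf A) => e e0.
have [s [N NP] sA] := inf_adherent e0 infA.
have [M MP] := almost_dec e e0.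
exists (maxn N M) => i; rewrite geq_max => /andP[iN iM].
have lo : inf A <= `|a i - b i| + e.
  apply: inf_lbound; first exact: infA.2.
  by exists i => j ij; rewrite -(subnKC ij) MP.
have := NP i iN; rewrite ler_norml => hi; apply/andP; split; lra.
Qed.

Context (uc : uniformly_convex E) (cC : convex_in C) (D : R).
Hypothesis bC : forall x, C x -> `|x| <= D.

(** Since [|a i - b i|] converges, every iterate of [f] nearly preserves it for large [i] and is
    almost affine on the segment. The constant in [nonexpansive_almost_affine] does not depend on
    the map, whence uniformity in [m]. *)
Lemma asymptotic_orbit_convex (a b : nat -> E) (t : R) : 0 <= t <= 1 ->
  asymptotic_orbit C f a -> asymptotic_orbit C f b ->
  asymptotic_orbit C f (fun i => t *: a i + (1 - t) *: b i).
Proof.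
move=> t01 oa ob; have [l lP] := asymptotic_orbit_dist _ _ oa ob.
have [Ca aP] := oa; have [Cb bP] := ob.
split=> [i|e e0]; first exact: cC.
have e2 : 0 < e / 2 by lra.
have [d d0 dP] := nonexpansive_almost_affine uc (2 * D) (e / 2) e2.
pose e' := Num.min (e / 2) (d / 4).
have e'0 : 0 < e' by rewrite lt_min e2 divr_gt0.
have [e'1 e'2] : e' <= e / 2 /\ e' <= d / 4 by rewrite /e' !ge_min !lexx orbT.
have [Nl NlP] := lP e' e'0; have [Na NaP] := aP e' e'0; have [Nb NbP] := bP e' e'0.
exists (maxn Nl (maxn Na Nb)) => i m; rewrite !geq_max => /and3P[il ia ib].
have am := NaP i m ia; have bm := NbP i m ib.
have : `|iter m f (t *: a i + (1 - t) *: b i) -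
    (t *: iter m f (a i) + (1 - t) *: iter m f (b i))| <= e / 2.
  apply: (dP C) => //; first exact: iter_nonexpansive.
    by rewrite (le_trans (ler_normB _ _))//; have := bC _ (Ca i); have := bC _ (Cb i); lra.
  have := NlP i il; have := NlP (i + m)%N (leq_trans il (leq_addr _ _)).
  have := ler_norm_sub3 (a (i + m)%N) (iter m f (a i)) (b (i + m)%N).
  have := ler_norm_sub3 (iter m f (a i)) (iter m f (b i)) (b (i + m)%N).
  rewrite (distrC (a (i + m)%N) (iter m f (a i))) !ler_norml; lra.
set w := (X in `|_ - X| <= _ -> _).
have : `|w - (t *: a (i + m)%N + (1 - t) *: b (i + m)%N)| <= e / 2.
  have -> : w - (t *: a (i + m)%N + (1 - t) *: b (i + m)%N) =
     t *: (iter m f (a i) - a (i + m)%N) + (1 - t) *: (iter m f (b i) - b (i + m)%N).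
    by rewrite /w; lmod_eq R [:: iter m f (a i); iter m f (b i); a (i + m)%N; b (i + m)%N]; ring.
  rewrite (le_trans (ler_normD _ _))// !normr_scale; try lra.
  have : t * `|iter m f (a i) - a (i + m)%N| <= t * (e / 2) by rewrite ler_wpM2l//; lra.
  have : (1 - t) * `|iter m f (b i) - b (i + m)%N| <= (1 - t) * (e / 2) by rewrite ler_wpM2l//; lra.
  lra.
by move=> h1 h2; rewrite (le_trans (ler_norm_sub3 _ w _))//; lra.
Qed.

Definition block_mean (u : nat -> E) (n i : nat) : E :=
  n.+1%:R^-1 *: \sum_(p < n.+1) u (i + p)%N.

Lemma block_mean0 u i : block_mean u 0 i = u i.
Proof. by rewrite /block_mean big_ord1 addn0 invr1 scale1r. Qed.

(** The two-point form lets facts about convex combinations pass to block means by induction on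
    [n]. *)
Lemma block_meanS u n i : block_mean u n.+1 i =
  (n.+1%:R / n.+2%:R) *: block_mean u n i + (1 - n.+1%:R / n.+2%:R) *: u (i + n.+1)%N.
Proof.
rewrite /block_mean big_ord_recr /= scalerDr scalerA; congr (_ *: _ + _ *: _).
  have n1 : n.+1%:R != 0 :> R by rewrite pnatr_eq0.
  by rewrite mulrC mulrA mulVf// mul1r.
have n2 : n.+2%:R != 0 :> R by rewrite pnatr_eq0.
by apply: (mulfI n2); rewrite mulrBr mulfV// mulr1 mulrCA mulfV// mulr1 -natr1 addrAC subrr add0r.
Qed.

Lemma block_weight (n : nat) : 0 <= (n.+1%:R / n.+2%:R : R) <= 1.
Proof. by rewrite divr_ge0 ?ler0n//= ler_pdivrMr ?ltr0n// mul1r ler_nat. Qed.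

Lemma block_mean_convex (K : set E) u n i : convex_in K ->
  (forall j, (i <= j)%N -> K (u j)) -> K (block_mean u n i).
Proof.
move=> cK Ku; elim: n => [|n IH]; first by rewrite block_mean0; apply: Ku.
by rewrite block_meanS; apply: cK => //; [apply: Ku; rewrite leq_addr|exact: block_weight].
Qed.

Lemma asymptotic_orbit_block_mean u n :
  asymptotic_orbit C f u -> asymptotic_orbit C f (block_mean u n).
Proof.
move=> ou; elim: n => [|n IH].
  by have -> : block_mean u 0 = u by apply/funext => i; rewrite block_mean0.
have -> : block_mean u n.+1 = fun i => (n.+1%:R / n.+2%:R) *: block_mean u n i +
    (1 - n.+1%:R / n.+2%:R) *: u (i + n.+1)%N.
  by apply/funext => i; rewrite block_meanS.
by apply: asymptotic_orbit_convex; [exact: block_weight|exact: IH|exact: asymptotic_orbit_shift].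
Qed.

(** [f] nearly maps the mean at [i] to the mean at [i + 1], and these differ by
    [(u i - u (i + n + 1)) / (n + 1)], of norm at most [2 D / (n + 1)]. *)
Lemma block_mean_approx_fixed u (eps : R) : asymptotic_orbit C f u -> 0 < eps ->
  exists n N, forall i, (N <= i)%N ->
    `|block_mean u n i - f (block_mean u n i)| <= eps.
Proof.
move=> ou e0; have e2 : 0 < eps / 2 by lra.
have [Cu _] := ou.
have D0 : 0 <= D := le_trans (normr_ge0 _) (bC _ (Cu 0%N)).
pose n := Num.truncn ((4 * D) / eps).
have [Ca /(_ _ e2) [N NP]] := asymptotic_orbit_block_mean u n ou.
exists n, N => i Ni; have := NP i 1%N Ni; rewrite /= addn1 => h.
rewrite (le_trans (ler_norm_sub3 _ (block_mean u n i.+1) _))// [X in _ + X]distrC.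
suff : `|block_mean u n i - block_mean u n i.+1| <= eps / 2 by lra.
rewrite /block_mean -scalerBr normr_scale ?invr_ge0 ?ler0n//.
have -> : \sum_(p < n.+1) u (i + p)%N - \sum_(p < n.+1) u (i.+1 + p)%N = u i - u (i.+1 + n)%N.
  rewrite big_ord_recl [in X in _ - X]big_ord_recr /= addn0.
  under eq_bigr do rewrite /bump /= add1n addnS -addSn.
  by rewrite opprD addrA addrK.
rewrite ler_pdivrMl ?ltr0n//.
have : 4 * D <= n.+1%:R * eps by rewrite -ler_pdivrMr// ltW// truncnS_gt.
have := ler_normB (u i) (u (i.+1 + n)%N); have := bC _ (Cu i); have := bC _ (Cu (i.+1 + n)%N).
lra.
Qed.
End NonexpansiveOrbits.

(** * The derivative of the norm *)

Section NormDerivative.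
Context {R : realType} {E : normedModType R}.

(** The difference quotient is cleared of its denominator, and uniformity is over balls instead of
    the unit sphere. Linearity of [g] is derived below. *)
Definition norm_derivative (a : E) (g : E -> R) : Prop :=
  forall D eps : R, 0 < eps -> exists2 d : R, 0 < d &
    forall (v : E) (t : R), `|v| <= D -> 0 < `|t| < d ->
      `| `|a + t *: v| - `|a| - t * g v| <= eps * `|t|.

(** By homogeneity: with [s = t |v| / |a|], [a + t v] is [|a|] times the sum of a unit vector and
    [s] times another. *)
Lemma frechet_norm_derivative (a : E) :
  frechet_differentiable_norm E -> a != 0 -> exists g, norm_derivative a g.
Proof.
move=> fd a0; have [l lP] := fd _ (normr_unit a a0).
have na : 0 < `|a| by rewrite normr_gt0.
exists (fun v => `|v| * l (`|v|^-1 *: v)) => D eps eps0.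
pose D' := Num.max D 1.
have D'0 : 0 < D' by rewrite lt_max ltr01 orbT.
have e0 : 0 < eps / D' by rewrite divr_gt0.
have [d d0 dP] : exists2 d : R, 0 < d & forall s, 0 < `|s| < d -> forall y : E, `|y| = 1 ->
    `| (`| `|a|^-1 *: a + s *: y| - `| `|a|^-1 *: a|) / s - l y| < eps / D'.
  have /lP : nbhs (l : {uniform` [set y : E | `|y| = 1] -> R})
      [set h : E -> R | forall y, `|y| = 1 -> `|h y - l y| < eps / D'].
    apply/uniform_nbhs; exists [set xy : R * R | `|xy.2 - xy.1| < eps / D']; split.
      rewrite -entourage_ballE; exists (eps / D') => //= -[x y] /=.
      by rewrite /ball /= distrC.
    by move=> h hP y y1; exact: hP.
  move=> [d /= d0 dP]; exists d => // s /andP[s0 sd] y y1.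
  apply: (dP s) => //=; first by rewrite sub0r normrN.
  by rewrite -normr_gt0.
exists (d * `|a| / D') => [|v t vD /andP[t0 td]]; first by rewrite divr_gt0 ?mulr_gt0.
have t0' : t != 0 by rewrite -normr_gt0.
have [->|v0] := eqVneq v 0.
  by rewrite scaler0 addr0 subrr normr0 mul0r mulr0 subr0 normr0 mulr_ge0// ltW.
have nv : 0 < `|v| by rewrite normr_gt0.
pose s := t * `|v| / `|a|.
have s0 : s != 0 by rewrite !mulf_neq0// ?invr_eq0 gt_eqF.
have ns : 0 < `|s| < d.
  rewrite normr_gt0 s0 /= /s !normrM normfV !normr_id ltr_pdivrMr//.
  apply: le_lt_trans (_ : `|t| * D' < _); last by rewrite -ltr_pdivlMr.
  by rewrite ler_wpM2l// le_max vD.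
have := dP s ns (`|v|^-1 *: v) (normr_unit v v0).
have -> : `|a|^-1 *: a + s *: (`|v|^-1 *: v) = `|a|^-1 *: (a + t *: v).
  by rewrite /s; lmod_eq R [:: a; v]; field; rewrite !gt_eqF.
rewrite normr_unit// normr_scale ?invr_ge0 ?(ltW na)//.
set w := l _; set A := `|a + t *: v| => h.
have -> : A - `|a| - t * (`|v| * w) = t * `|v| * ((`|a|^-1 * A - 1) / s - w).
  by rewrite /s; field; rewrite t0' !gt_eqF.
rewrite !normrM normr_id -mulrA mulrC ler_pM2r//.
apply: le_trans (_ : D' * (eps / D') <= _); last by rewrite mulrCA mulfV ?mulr1// gt_eqF.
by rewrite ler_pM// ?(ltW h)// le_max vD.
Qed.

Section Linearity.
Context (a : E) (g : E -> R).
Hypothesis ga : norm_derivative a g.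

Lemma norm_derivative_unique v (c : R) :
  (forall eps : R, 0 < eps -> exists2 d : R, 0 < d & forall t : R, 0 < t < d ->
     `| `|a + t *: v| - `|a| - t * c| <= eps * t) -> g v = c.
Proof.
move=> h; apply/eqP; rewrite -subr_eq0 -normr_le0; apply/ler_addgt0Pl => e e0; rewrite addr0.
have e2 : 0 < e / 2 by lra.
have [d d0 dP] := ga `|v| _ e2; have [d' d'0 d'P] := h _ e2.
pose t := Num.min d d' / 2.
have t0 : 0 < t by rewrite divr_gt0// lt_min d0.
have : Num.min d d' / 2 < Num.min d d' by rewrite ltr_pdivrMr// ltr_pMr ?ltr1n// lt_min d0.
rewrite lt_min -/t => /andP[td td'].
have /(_ _)/= h1 := dP v t (lexx _); have h2 := d'P t.
move: h1 h2; rewrite gtr0_norm// t0 td td' => /(_ isT) h1 /(_ isT) h2.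
rewrite -(ler_pM2l t0) -[X in X * `|_|](gtr0_norm t0) -normrM.
have -> : t * (g v - c) = (`|a + t *: v| - `|a| - t * c) - (`|a + t *: v| - `|a| - t * g v).
  by ring.
by rewrite (le_trans (ler_normB _ _))//; lra.
Qed.

Lemma norm_derivativeZ (r : R) v : g (r *: v) = r * g v.
Proof.
have [->|r0] := eqVneq r 0.
  rewrite scale0r mul0r; apply: norm_derivative_unique => e e0; exists 1 => // t /andP[t0 _].
  by rewrite scaler0 addr0 subrr mulr0 subr0 normr0 mulr_ge0// ltW.
have nr : 0 < `|r| by rewrite normr_gt0.
apply: norm_derivative_unique => e e0.
have [d d0 dP] := ga `|v| (e / `|r|) (divr_gt0 e0 nr).
exists (d / `|r|) => [|t /andP[t0 td]]; first by rewrite divr_gt0.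
have : 0 < `|t * r| < d.
  by rewrite normrM (gtr0_norm t0) -ltr_pdivlMr// td andbT mulr_gt0.
move=> /(dP v _ (lexx _)); rewrite scalerA mulrA normrM (gtr0_norm t0).
by have -> : e / `|r| * (t * `|r|) = e * t by field; rewrite gt_eqF.
Qed.

Lemma norm_derivativeN v : g (- v) = - g v.
Proof. by rewrite -scaleN1r norm_derivativeZ mulN1r. Qed.

Lemma norm_derivative_bound v : g v <= `|v|.
Proof.
apply/ler_addgt0Pl => e e0.
have [d d0 dP] := ga `|v| _ e0.
have t0 : 0 < d / 2 by rewrite divr_gt0.
have := dP v (d / 2) (lexx _); rewrite gtr0_norm// t0 /= => /(_ _) h.
have {}h : `| `|a + (d / 2) *: v| - `|a| - d / 2 * g v| <= e * (d / 2) by apply: h; lra.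
move: h; rewrite ler_norml => /andP[h1 _].
have h4 : `|a + (d / 2) *: v| <= `|a| + d / 2 * `|v|.
  by rewrite -(normr_scale (d / 2) v) ?(ltW t0)// ler_normD.
rewrite -(ler_pM2l t0); lra.
Qed.

(** Convexity of the norm: [2 |a + t (v + w)| <= |a + 2 t v| + |a + 2 t w|], expanded to first order
    in [t]. *)
Lemma norm_derivativeD_le v w : g (v + w) <= g v + g w.
Proof.
apply/ler_addgt0Pl => e e0; have e4 : 0 < e / 4 by lra.
pose M := Num.max `|v + w| (Num.max `|v| `|w|).
have [d d0 dP] := ga M _ e4.
pose t := d / 4.
have t0 : 0 < t by rewrite divr_gt0.
have h x s : `|x| <= M -> 0 < s < d -> `| `|a + s *: x| - `|a| - s * g x| <= e / 4 * s.
  by move=> xM /andP[s0 sd]; have := dP x s xM; rewrite gtr0_norm// s0 sd; apply.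
have hv : `|v| <= M by rewrite /M !le_max lexx orbT.
have hw : `|w| <= M by rewrite /M !le_max lexx !orbT.
have hvw : `|v + w| <= M by rewrite /M !le_max lexx.
have := h _ t hvw; have := h _ (2 * t) hv; have := h _ (2 * t) hw.
have dt : d = 4 * t by rewrite /t; field.
have td : 0 < t < d by rewrite t0; lra.
have t2d : 0 < 2 * t < d by lra.
move=> /(_ t2d); rewrite ler_norml => /andP[_ w2].
move=> /(_ t2d); rewrite ler_norml => /andP[_ v2].
move=> /(_ td); rewrite ler_norml => /andP[vw1 _].
clearbody t.
have : 2 * `|a + t *: (v + w)| <= `|a + (2 * t) *: v| + `|a + (2 * t) *: w|.
  rewrite -normr_scale ?ler0n//; apply: le_trans (ler_normD _ _).
  suff -> : 2 *: (a + t *: (v + w)) = a + (2 * t) *: v + (a + (2 * t) *: w) by [].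
  by lmod_eq R [:: a; v; w]; ring.
move=> tri; have et : 0 < e * t by rewrite mulr_gt0.
rewrite -(ler_pM2l t0); lra.
Qed.

Lemma norm_derivativeD v w : g (v + w) = g v + g w.
Proof.
apply/eqP; rewrite eq_le norm_derivativeD_le /=.
have := norm_derivativeD_le (v + w) (- w); rewrite addrK norm_derivativeN; lra.
Qed.

Lemma norm_derivative_self : g a = `|a|.
Proof.
apply: norm_derivative_unique => e e0; exists 1 => // t /andP[t0 _].
have -> : a + t *: a = (1 + t) *: a by lmod_eq R [:: a]; ring.
rewrite normr_scale ?addr_ge0 ?ler01 ?(ltW t0)//.
by have -> : (1 + t) * `|a| - `|a| - t * `|a| = 0; [ring|rewrite normr0 mulr_ge0// ltW].
Qed.
End Linearity.
End NormDerivative.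

(* The points common to all closed convex sets containing a tail of u: in a
   reflexive space, the closed convex hull of the weak cluster points of u. *)
Definition convex_core {R : realType} {E : normedModType R} (u : nat -> E) : set E :=
  [set w | forall K : set E, convex_in K -> closed K ->
    (exists N, forall i, (N <= i)%N -> K (u i)) -> K w].

Lemma convex_core_sub {R : realType} {E : normedModType R} (u v : nat -> E) :
  (forall (K : set E) N, convex_in K -> (forall i, (N <= i)%N -> K (u i)) ->
     exists M, forall i, (M <= i)%N -> K (v i)) ->
  convex_core v `<=` convex_core u.
Proof. by move=> uv w wv K cK clK [N NP]; apply: wv => //; exact: uv NP. Qed.

Lemma closed_le_lipschitz {R : realType} {E : normedModType R} (h : E -> R) (c : R) :
  (forall x y, h x - h y <= `|x - y|) -> closed [set x | h x <= c].
Proof.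
move=> lh; rewrite closedE => x /= xc; rewrite leNgt; apply/negP => cx; apply: xc.
apply/nbhs_ballP; exists (h x - c) => /=; first by rewrite subr_gt0.
by move=> y; rewrite -ball_normE /= => xy yc; have := lh x y; lra.
Qed.

(** * Fixed points in the convex core *)

Section FixedPointsOfTheCore.
Context {R : realType} {E : completeNormedModType R} (C : set E) (f : E -> E) (D : R).
Hypotheses (uc : uniformly_convex E) (fd : frechet_differentiable_norm E).
Hypotheses (fC : forall x, C x -> C (f x)) (nf : nonexpansive_on C f).
Hypotheses (cC : convex_in C) (clC : closed C) (bC : forall x, C x -> `|x| <= D).

(* The distances from [t u i + (1 - t) w1] to [w2] converge for each t; dividing
   by t and using that the norm has a uniform derivative at [w1 - w2], so do the
   values of that derivative at [u i - w1]. *)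
Lemma norm_derivative_orbit_cauchy (u : nat -> E) (w1 w2 : E) (g : E -> R) :
  asymptotic_orbit C f u -> C w1 -> C w2 -> f w1 = w1 -> f w2 = w2 ->
  norm_derivative (w1 - w2) g ->
  forall eps : R, 0 < eps -> exists N, forall i j, (N <= i)%N -> (N <= j)%N ->
    g (u i - w1) <= g (u j - w1) + eps.
Proof.
move=> ou Cw1 Cw2 fw1 fw2 ga e e0; have [Cu _] := ou.
have e4 : 0 < e / 4 by lra.
have [d d0 dP] := ga (2 * D) _ e4.
pose t := Num.min (d / 2) 1.
have t0 : 0 < t by rewrite lt_min divr_gt0/=.
have t1 : t <= 1 by rewrite ge_min lexx orbT.
have td : t < d.
  have : t <= d / 2 by rewrite ge_min lexx.
  lra.
have t01 : 0 <= t <= 1 by rewrite ltW.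
have [l lP] := asymptotic_orbit_dist _ _ fC nf _ _
  (asymptotic_orbit_convex _ _ fC nf uc cC D bC _ _ _ t01 ou
    (asymptotic_orbit_fixed _ _ _ Cw1 fw1))
  (asymptotic_orbit_fixed _ _ _ Cw2 fw2).
have et : 0 < e / 4 * t by rewrite mulr_gt0.
have [N NP] := lP _ et; exists N => i j Ni Nj.
(* Half of the error comes from the limit [l], half from the first-order expansion. *)
have near k : (N <= k)%N -> `|l - `|w1 - w2| - t * g (u k - w1)| <= e / 2 * t.
  move=> Nk; have := NP k Nk.
  have -> : t *: u k + (1 - t) *: w1 - w2 = w1 - w2 + t *: (u k - w1).
    by lmod_eq R [:: u k; w1; w2]; ring.
  have : `|u k - w1| <= 2 * D.
    by rewrite (le_trans (ler_normB _ _))//; have := bC _ (Cu k); have := bC _ Cw1; lra.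
  move=> /(dP _ t); rewrite gtr0_norm// t0 td => /(_ isT).
  rewrite !ler_norml => /andP[? ?] /andP[? ?]; apply/andP; split; lra.
have := near i Ni; have := near j Nj.
rewrite !ler_norml => /andP[? ?] /andP[? ?].
rewrite -(ler_pM2l t0); lra.
Qed.

(** Let [g] be the derivative of the norm at [w1 - w2]. Its values along [u] are Cauchy, so closed
    half-spaces bounded near [g (u N)] contain tails of [u]. This gives [g w1 <= g w2 + e] for all
    [e > 0], against [g (w1 - w2) = |w1 - w2| > 0]. *)
Lemma core_fixed_unique (u : nat -> E) (w1 w2 : E) :
  asymptotic_orbit C f u -> C w1 -> C w2 -> f w1 = w1 -> f w2 = w2 ->
  convex_core u w1 -> convex_core u w2 -> w1 = w2.
Proof.
move=> ou Cw1 Cw2 fw1 fw2 cw1 cw2; apply/eqP; rewrite -subr_eq0.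
apply/negP => /negP a0.
have [g ga] := frechet_norm_derivative (w1 - w2) fd a0.
have cau := norm_derivative_orbit_cauchy _ _ _ _ ou Cw1 Cw2 fw1 fw2 ga.
have gB x y : g (x - y) = g x - g y.
  by rewrite (norm_derivativeD _ _ ga) (norm_derivativeN _ _ ga).
have sep w w' (e : R) : 0 < e -> convex_core u w -> convex_core u w' -> g w <= g w' + e.
  move=> e0 cw cw'; have e2 : 0 < e / 2 by lra.
  have [N NP] := cau _ e2.
  pose c := g (u N).
  have K1 : [set x | g x <= c + e / 2] w.
    apply: cw.
    - move=> x y t /= xc yc t01.
      rewrite (norm_derivativeD _ _ ga) !(norm_derivativeZ _ _ ga).
      have : t * g x <= t * (c + e / 2) by rewrite ler_wpM2l//; lra.
      have : (1 - t) * g y <= (1 - t) * (c + e / 2) by rewrite ler_wpM2l//; lra.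
      lra.
    - by apply: closed_le_lipschitz => x y; rewrite -gB (norm_derivative_bound _ _ ga).
    - by exists N => i Ni /=; have := NP i N Ni (leqnn N); rewrite !gB /c; lra.
  have K2 : [set x | - g x <= - c + e / 2] w'.
    apply: cw'.
    - move=> x y t /= xc yc t01.
      rewrite (norm_derivativeD _ _ ga) !(norm_derivativeZ _ _ ga).
      have : t * - g x <= t * (- c + e / 2) by rewrite ler_wpM2l//; lra.
      have : (1 - t) * - g y <= (1 - t) * (- c + e / 2) by rewrite ler_wpM2l//; lra.
      lra.
    - apply: closed_le_lipschitz => x y.
      by rewrite opprK addrC -gB distrC (norm_derivative_bound _ _ ga).
    - by exists N => i Ni /=; have := NP N i (leqnn N) Ni; rewrite !gB /c; lra.
  by move: K1 K2 => /=; lra.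
have := sep w1 w2 (`|w1 - w2| / 2).
rewrite divr_gt0 ?normr_gt0// => /(_ isT cw1 cw2).
have := norm_derivative_self _ _ ga; rewrite gB; have : 0 < `|w1 - w2| by rewrite normr_gt0.
lra.
Qed.

Lemma core_fixed_exists (u v : nat -> E) :
  (forall i, C (v i)) -> convex_core v `<=` convex_core u ->
  (forall eps : R, 0 < eps -> exists N, forall i, (N <= i)%N -> `|v i - f (v i)| <= eps) ->
  exists w, [/\ C w, f w = w, convex_core u w & convex_core v w].
Proof.
move=> Cv vu vf; have [w [Cw fw wv]] := demiclosed_cluster uc _ _ _ _ clC cC bC nf Cv vf.
by exists w; split => //; apply: vu.
Qed.

End FixedPointsOfTheCore.

Lemma halfspace_closed {R : realType} {E : normedModType R} (h : {linear E -> R^o}) (c : R) :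
  continuous h -> closed [set x | h x <= c].
Proof.
move=> ch; apply: (@closed_comp _ _ h [set y : R | y <= c]); last exact: closed_le.
by move=> x _; exact: ch.
Qed.

Lemma halfspace_convex {R : realType} {E : normedModType R} (h : {linear E -> R^o}) (c : R) :
  convex_in [set x | h x <= c].
Proof.
move=> x y t /= xc yc t01; rewrite linearD !linearZ /=.
have : t * h x <= t * c by rewrite ler_wpM2l//; lra.
have : (1 - t) * h y <= (1 - t) * c by rewrite ler_wpM2l//; lra.
rewrite /GRing.scale /=; lra.
Qed.

(** * Weak convergence *)

Section WeakConvergence.
Context {R : realType} {E : completeNormedModType R} (C : set E) (f : E -> E) (D : R).
Hypotheses (uc : uniformly_convex E) (fd : frechet_differentiable_norm E).
Hypotheses (fC : forall x, C x -> C (f x)) (nf : nonexpansive_on C f).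
Hypotheses (cC : convex_in C) (clC : closed C) (bC : forall x, C x -> `|x| <= D).

(** The last clause puts [v] in the convex hull of the tail of [u] from [N] on. Block means and
    almost fixed terms of [u] are both covered. *)
Definition tail_approx_fixed (u : nat -> E) (N : nat) (eps : R) (v : E) : Prop :=
  [/\ C v, `|v - f v| <= eps & forall K : set E, convex_in K ->
    (forall i, (N <= i)%N -> K (u i)) -> K v].

Lemma tail_approx_fixed_le (u : nat -> E) N N' eps eps' v :
  (N <= N')%N -> eps' <= eps ->
  tail_approx_fixed u N' eps' v -> tail_approx_fixed u N eps v.
Proof.
move=> NN ee [Cv vf vK]; split=> //; first exact: le_trans ee.
by move=> K cK KN; apply: vK => // i Ni; apply: KN; rewrite (leq_trans NN).
Qed.

(** A demicluster point of such [v], taken for [N = n] and [eps = 1 / (n + 1)], is fixed and lies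
    both in the core and in [K]. *)
Lemma frequent_core_fixed (u : nat -> E) (K : set E) :
  convex_in K -> closed K ->
  (forall eps N, 0 < eps -> exists2 v, K v & tail_approx_fixed u N eps v) ->
  exists w, [/\ C w, f w = w, convex_core u w & K w].
Proof.
move=> cK clK freq.
have [n|v vP] := choice (P := fun n v => K v /\ tail_approx_fixed u n n.+1%:R^-1 v).
  by have [|v Kv tv] := freq n.+1%:R^-1 n; [rewrite invr_gt0|exists v].
have Cv i : C (v i) by have [_ []] := vP i.
have vu : convex_core v `<=` convex_core u.
  apply: convex_core_sub => K' N cK' KN; exists N => i Ni.
  have [_ [_ _]] := vP i; apply=> // j ij; apply: KN; exact: leq_trans ij.
have [|w [Cw fw cw cvw]] := core_fixed_exists _ _ _ uc nf cC clC bC u v Cv vu.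
  move=> e e0; exists (Num.truncn e^-1) => i Ni.
  have [_ [_ vf _]] := vP i; apply: le_trans vf _.
  rewrite invf_ple ?posrE ?ltr0n// ltW// (lt_le_trans (truncnS_gt _))//.
  by rewrite ler_nat ltnS.
exists w; split=> //; apply: cvw => //; exists 0%N => i _; exact: (vP i).1.
Qed.

Lemma tail_block_mean (u : nat -> E) N eps : asymptotic_orbit C f u -> 0 < eps ->
  exists n M, forall i, (M <= i)%N -> tail_approx_fixed u N eps (block_mean u n i).
Proof.
move=> ou e0.
have [n [M MP]] := block_mean_approx_fixed _ _ fC nf uc cC _ bC _ _ ou e0.
exists n, (maxn N M) => i; rewrite geq_max => /andP[Ni Mi]; split.
- by apply: block_mean_convex => // j _; exact: ou.1.
- exact: MP.
- by move=> K cK KN; apply: block_mean_convex => // j ij; apply/KN/(leq_trans Ni).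
Qed.

Lemma core_fixed_point (u : nat -> E) : asymptotic_orbit C f u ->
  exists w, [/\ C w, f w = w & convex_core u w].
Proof.
move=> ou; have [||e N e0|w [? ? ? _]] := @frequent_core_fixed u setT.
- by [].
- exact: closedT.
- have [n [M MP]] := tail_block_mean u N e ou e0.
  by exists (block_mean u n M) => //; exact: MP.
- by exists w.
Qed.

(** Otherwise one of the half-spaces [h <= h z - eps] and [h >= h z + eps] would contain such [v]
    for all [N] and [d], hence a fixed point of the core; but [z] is the only one. *)
Lemma core_weak_approx (u : nat -> E) (z : E) (h : {linear E -> R^o}) (eps : R) :
  asymptotic_orbit C f u -> C z -> f z = z -> convex_core u z ->
  continuous h -> 0 < eps ->
  exists N (d : R), 0 < d /\ forall v, tail_approx_fixed u N d v -> `|h v - h z| <= eps.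
Proof.
move=> ou Cz fz cz ch e0.
have half (K : set E) : convex_in K -> closed K -> ~ K z -> exists N (d : R), 0 < d /\
    forall v, tail_approx_fixed u N d v -> ~ K v.
  move=> cK clK nKz; apply: contrapT => nex.
  have [d N d0|w [Cw fw cw Kw]] := frequent_core_fixed u K cK clK.
    apply: contrapT => nv; apply: nex; exists N, d; split=> // v tv Kv.
    by apply: nv; exists v.
  by apply: nKz; rewrite (core_fixed_unique _ _ _ uc fd fC nf cC bC u z w).
have [|N1 [d1 [d10 dP1]]] := half _ (halfspace_convex h (h z - eps)) (halfspace_closed h _ ch).
  by move=> /=; lra.
have cone : convex_in [set x | h z + eps <= h x].
  move=> x y t /= xc yc t01; rewrite linearD !linearZ /=.
  have : t * (h z + eps) <= t * h x by rewrite ler_wpM2l//; lra.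
  have : (1 - t) * (h z + eps) <= (1 - t) * h y by rewrite ler_wpM2l//; lra.
  rewrite /GRing.scale /=; lra.
have [||N2 [d2 [d20 dP2]]] := half _ cone.
- apply: (@closed_comp _ _ h [set y : R | h z + eps <= y]); last exact: closed_ge.
  by move=> x _; exact: ch.
- by move=> /=; lra.
exists (maxn N1 N2), (Num.min d1 d2); split=> [|v tv]; first by rewrite lt_min d10.
have /dP1 /= h1 : tail_approx_fixed u N1 d1 v.
  by apply: tail_approx_fixed_le tv; rewrite ?leq_maxl// ge_min lexx.
have /dP2 /= h2 : tail_approx_fixed u N2 d2 v.
  by apply: tail_approx_fixed_le tv; rewrite ?leq_maxr// ge_min lexx orbT.
move/negP: h1; move/negP: h2; rewrite -!ltNge => h2 h1.
by rewrite ler_norml; apply/andP; split; lra.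
Qed.

Lemma orbit_weakly_cvg (u : nat -> E) : asymptotic_orbit C f u ->
  (forall eps : R, 0 < eps -> exists N, forall i, (N <= i)%N -> `|u i - f (u i)| <= eps) ->
  exists z, [/\ C z, f z = z & weakly_cvg u z].
Proof.
move=> ou uf; have [z [Cz fz cz]] := core_fixed_point u ou.
exists z; split=> // h ch; apply/cvgrPdist_le => e e0.
have [N [d [d0 dP]]] := core_weak_approx u z h e ou Cz fz cz ch e0.
have [M MP] := uf d d0; exists (maxn N M) => // i /=; rewrite geq_max => /andP[Ni Mi].
rewrite distrC; apply: dP; split; [exact: ou.1|exact: MP|].
by move=> K _; apply.
Qed.

(** Passes from block sums to partial sums: strong induction removes the last block, and [A] absorbs
    the first [M + n + 1] terms. *)
Lemma sum_le_of_blocks (r : nat -> R) (n M : nat) (eps : R) : 0 <= eps ->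
  (forall i, (M <= i)%N -> `|\sum_(p < n.+1) r (i + p)%N| <= n.+1%:R * eps) ->
  exists A : R, forall k, `|\sum_(i < k) r i| <= A + k%:R * eps.
Proof.
move=> e0 rM; pose A := \sum_(i < M + n.+1) `|r i|; exists A.
elim/ltn_ind => k IH; have [kM|Mk] := ltnP k (M + n.+1)%N.
  rewrite (le_trans (ler_norm_sum _ _ _))// ler_wpDr ?mulr_ge0//.
  rewrite /A -(subnKC (ltnW kM)) big_split_ord /= lerDl.
  by apply: sumr_ge0.
have [l kE] : exists l, k = (l + n.+1)%N by exists (k - n.+1)%N; lia.
move: IH Mk; rewrite {}kE => IH Mk.
rewrite big_split_ord /= (le_trans (ler_normD _ _))//.
have lk : (l < l + n.+1)%N by lia.
have Ml : (M <= l)%N by lia.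
have := IH _ lk; have := rM _ Ml; rewrite natrD mulrDl; lra.
Qed.

Lemma means_weakly_cvg (x : E) (x_ : nat -> E) : C x ->
  (forall k, (1 <= k)%N -> x_ k = k%:R^-1 *: \sum_(1 <= i < k.+1) iter i f x) ->
  exists z, [/\ C z, f z = z & weakly_cvg x_ z].
Proof.
(* The means begin with [f x], so [u] is the orbit of [f x]. *)
move=> Cx x_E; pose u i := iter i f (f x).
have ou : asymptotic_orbit C f u by apply: asymptotic_orbit_iter => //; exact: fC.
have [z [Cz fz cz]] := core_fixed_point u ou.
exists z; split=> // h ch; apply/cvgrPdist_le => e e0.
have e2 : 0 < e / 2 by lra.
have [N [d [d0 dP]]] := core_weak_approx u z h _ ou Cz fz cz ch e2.
have [n [M MP]] := tail_block_mean u N d ou d0.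
pose r i : R := h (u i) - h z.
have [|i Mi|A AP] := @sum_le_of_blocks r n M (e / 2).
- exact: ltW.
- have := dP _ (MP i Mi); rewrite /block_mean linearZ linear_sum /GRing.scale /= => hb.
  have -> : \sum_(p < n.+1) r (i + p)%N =
     n.+1%:R * (n.+1%:R^-1 * \sum_(p < n.+1) h (u (i + p)%N) - h z).
    rewrite mulrBr mulrA mulfV ?mul1r ?pnatr_eq0// /r sumrB sumr_const card_ord.
    by rewrite -[h z *+ _]mulr_natl.
  by rewrite normrM ger0_norm ?ler0n// ler_wpM2l.
(* From [k0] on, the constant [A] contributes at most [e / 2] to the mean. *)
pose k0 := (Num.truncn (A / (e / 2))).+1.
exists k0 => // k /= kk; have k1 : (0 < k)%N by exact: leq_trans kk.
have kp : 0 < k%:R :> R by rewrite ltr0n.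
rewrite x_E// linearZ linear_sum /GRing.scale /= big_add1 big_mkord /=.
rewrite -(ler_pM2l kp) -[X in X * `|_|](gtr0_norm kp) -normrM mulrBr mulrA mulfV ?gt_eqF// mul1r.
have -> : k%:R * h z - \sum_(i < k) h (f (iter i f x)) = - \sum_(i < k) r i.
  rewrite /r sumrB sumr_const card_ord -[h z *+ _]mulr_natl opprB.
  by under [in RHS]eq_bigr do rewrite /u -iterSr.
rewrite normrN (le_trans (AP k))//.
have : A <= k%:R * (e / 2).
  rewrite -ler_pdivrMr// ltW// (lt_le_trans (truncnS_gt _))// ler_nat; exact: kk.
lra.
Qed.

End WeakConvergence.

(** * Common fixed points *)

Lemma convex_set_in {R : realType} {E : lmodType R} (C : set E) :
  convex_set (C : set (convex_lmodType E)) -> convex_in C.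
Proof.
move=> cC x y t Cx Cy /andP[t0 t1].
by have /= := cC x y (Itv01 t0 t1) (mem_set Cx) (mem_set Cy); rewrite inE.
Qed.

Section FixedPointSets.
Context {R : realType} {E : completeNormedModType R} (D : R).
Hypothesis uc : uniformly_convex E.

Lemma fixed_set_convex (C : set E) (f : E -> E) :
  convex_in C -> (forall x, C x -> `|x| <= D) -> nonexpansive_on C f ->
  convex_in [set x | C x /\ f x = x].
Proof.
move=> cC bC nf x y t [Cx fx] [Cy fy] t01; split; first exact: cC.
apply/eqP; rewrite eq_sym -subr_eq0 -normr_le0; apply/ler_addgt0Pl => e e0; rewrite addr0.
have [d d0 dP] := approx_fixed_segment uc (2 * D) e e0.
apply: (dP C) => //; rewrite ?fx ?fy ?subrr ?normr0 ?(ltW d0)//.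
by rewrite (le_trans (ler_normB _ _))//; have := bC _ Cx; have := bC _ Cy; lra.
Qed.

Lemma fixed_set_closed (C : set E) (f : E -> E) :
  closed C -> nonexpansive_on C f -> closed [set x | C x /\ f x = x].
Proof.
move=> clC nf x /= clx.
have near e : 0 < e -> exists y, [/\ C y, f y = y & `|x - y| < e].
  move=> e0; have [y [[Cy fy] xy]] := clx _ (nbhsx_ballx x e e0).
  by exists y; split => //; move: xy; rewrite -ball_normE.
have Cx : C x.
  by apply: closed_limit => // e /near[y [Cy _ xy]]; exists y.
split=> //; apply/eqP; rewrite -subr_eq0 -normr_le0; apply/ler_addgt0Pl => e e0; rewrite addr0.
have [|y [Cy fy xy]] := near (e / 2); first lra.
have := nf _ _ Cx Cy; rewrite fy; have := ler_norm_sub3 (f x) y x; rewrite (distrC y); lra.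
Qed.

(** By induction on [m]: the fixed points of [f ord0] form a nonempty closed convex set, invariant
    under the other maps because they commute with it. *)
Lemma commuting_fixed_point (C : set E) (m : nat) (f : 'I_m -> E -> E) :
  convex_in C -> closed C -> (forall x, C x -> `|x| <= D) -> C !=set0 ->
  (forall i x, C x -> C (f i x)) -> (forall i, nonexpansive_on C (f i)) ->
  (forall i j x, C x -> f i (f j x) = f j (f i x)) ->
  exists z, C z /\ forall i, f i z = z.
Proof.
elim: m C f => [|m IH] C f cC clC bC [x0 Cx0] fC nf comm.
  by exists x0; split => // -[].
pose F := [set x | C x /\ f ord0 x = x].
have [|||||||z [[Cz f0z] fz]] := IH F (fun i => f (lift ord0 i)).
- exact: fixed_set_convex.
- exact: fixed_set_closed.
- by move=> x [Cx _]; exact: bC.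
- have [w [Cw fw _]] := core_fixed_point C (f ord0) D uc (fC ord0) (nf ord0) cC clC bC _
    (asymptotic_orbit_iter C (f ord0) (fC ord0) _ Cx0).
  by exists w.
- by move=> i x [Cx fx]; split; [exact: fC|rewrite comm// fx].
- by move=> i x y [Cx _] [Cy _]; exact: nf.
- by move=> i j x [Cx _]; exact: comm.
by exists z; split => // i; case: (unliftP ord0 i) => [j ->|->].
Qed.

(** Strict convexity, with [z] as origin: the vectors [f j x - z] have norm at most [|x - z|], and
    their weighted mean is [x - z] itself. So the [i]-th one must equal the mean [w] of the
    others. *)
Lemma convex_combination_fixed (m : nat) (lambda : 'I_m -> R) (f : 'I_m -> E -> E)
    (C : set E) (x z : E) :
  (forall i, 0 < lambda i < 1) -> \sum_i lambda i = 1 ->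
  (forall i, nonexpansive_on C (f i)) -> C x -> C z -> (forall i, f i z = z) ->
  \sum_i lambda i *: f i x = x -> forall i, f i x = x.
Proof.
move=> l01 l1 nf Cx Cz fz xE i.
pose v j := f j x - z.
have vx j : `|v j| <= `|x - z| by rewrite /v -{1}(fz j); exact: nf.
have vE : \sum_j lambda j *: v j = x - z.
  by rewrite -[X in _ = X - _]xE -[z in RHS]scale1r -l1 scaler_suml -sumrB;
    apply: eq_bigr => j _; rewrite scalerBr.
have /andP[li0 li1] := l01 i.
have q0 : 0 < 1 - lambda i by lra.
pose w := (1 - lambda i)^-1 *: \sum_(j | j != i) lambda j *: v j.
have wx : `|w| <= `|x - z|.
  rewrite normr_scale ?invr_ge0 ?(ltW q0)// ler_pdivrMl//.
  rewrite (le_trans (ler_norm_sum _ _ _))//.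
  have -> : 1 - lambda i = \sum_(j | j != i) lambda j.
    by rewrite -l1 (bigD1 i)//= addrAC subrr add0r.
  rewrite mulr_suml; apply: ler_sum => j _; have /andP[/ltW lj _] := l01 j.
  by rewrite normr_scale// ler_wpM2l.
have comb : lambda i *: v i + (1 - lambda i) *: w = x - z.
  by rewrite /w scalerA mulfV ?gt_eqF// scale1r -vE [RHS](bigD1 i).
have vw : v i = w.
  apply/eqP; rewrite -subr_eq0 -normr_le0.
  have p0 : 0 < lambda i * (1 - lambda i) by rewrite mulr_gt0.
  rewrite -(ler_pM2l p0) mulr0; apply/ler_addgt0Pl => e e0; rewrite addr0.
  have [d d0 dP] := uniformly_convex_weighted uc `|x - z| e e0.
  apply: (dP `|x - z|) => //; first by rewrite !ltW.
  by rewrite comb; lra.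
have : v i = x - z.
  by rewrite -comb -vw; lmod_eq R [:: v i]; ring.
by move=> /addIr.
Qed.

End FixedPointSets.

(** * Fixed points of the semigroup *)

Section SemigroupFixedPoints.
Context {R : realType} {E : normedModType R} (n : nat) (tau : topology_on E).
Context (C : set E) (T : 'rV[R]_n -> E -> E).
Hypothesis T_sg : nonexpansive_semigroup tau C T.
Context (m : nat) (p : 'I_m -> 'rV[R]_n) (z : E).
Hypotheses (p_ge0 : forall j, nonneg_orthant (p j)) (Cz : C z).
Hypothesis (pz : forall j, T (p j) z = z).

Lemma orthant0 : nonneg_orthant (0 : 'rV[R]_n).
Proof. by move=> i; rewrite mxE. Qed.

Lemma orthantD (q r : 'rV[R]_n) : nonneg_orthant q -> nonneg_orthant r -> nonneg_orthant (q + r).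
Proof. by move=> q0 r0 i; rewrite mxE addr_ge0. Qed.

Lemma orthant_nat_sum (k : 'I_m -> nat) : nonneg_orthant (\sum_j (k j)%:R *: p j).
Proof.
move=> i; rewrite summxE; apply: sumr_ge0 => j _.
by rewrite mxE mulr_ge0// p_ge0.
Qed.

Lemma semigroup_fixD (q r : 'rV[R]_n) : nonneg_orthant q -> nonneg_orthant r ->
  T q z = z -> T r z = z -> T (q + r) z = z.
Proof. by move=> q0 r0 qz rz; rewrite (semigroupD T_sg)// rz. Qed.

(* [T 0] need not be the identity, whence the detour by [p j]. *)
Lemma semigroup_fix_nat_sum (k : 'I_m -> nat) : (0 < m)%N ->
  T (\sum_j (k j)%:R *: p j) z = z.
Proof.
move=> m0; pose j0 := Ordinal m0.
have z0 : T 0 z = z.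
  rewrite -{1}(pz j0) -(semigroupD T_sg) ?add0r//; exact: orthant0.
have fixN j (l : nat) : T (l%:R *: p j) z = z /\ nonneg_orthant (l%:R *: p j).
  split; last by move=> i; rewrite mxE mulr_ge0// p_ge0.
  elim: l => [|l IH]; first by rewrite scale0r.
  rewrite -natr1 scalerDl scale1r semigroup_fixD//.
  by move=> i; rewrite mxE mulr_ge0// p_ge0.
suff [] : T (\sum_j (k j)%:R *: p j) z = z /\ nonneg_orthant (\sum_j (k j)%:R *: p j) by [].
elim/big_rec: _ => [|j q _ [qz q0]]; first by split; [|exact: orthant0].
by have [? ?] := fixN j (k j); split; [exact: semigroup_fixD|exact: orthantD].
Qed.

(** Negative coefficients move to the other side: if [q + a = b] with [a] and [b] natural
    combinations, then [T q z = T q (T a z) = T b z = z]. *)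
Lemma semigroup_fix_int_sum (nu : 'I_m -> int) : (0 < m)%N ->
  nonneg_orthant (\sum_j (nu j)%:~R *: p j) -> T (\sum_j (nu j)%:~R *: p j) z = z.
Proof.
move=> m0; set q := \sum_j _ => q0.
(* [Negz l] stands for [- (l + 1)], whence the successor. *)
pose kn j := if nu j is Negz l then l.+1 else 0%N.
pose kp j := if nu j is Posz l then l else 0%N.
have qE : q + \sum_j (kn j)%:R *: p j = \sum_j (kp j)%:R *: p j.
  rewrite -big_split; apply: eq_bigr => j _ /=; rewrite -scalerDl /kn /kp.
  by case: (nu j) => l; rewrite ?addr0// NegzE rmorphN /= addNr.
rewrite -{1}(semigroup_fix_nat_sum kn m0) -(semigroupD T_sg)//.
  by rewrite qE semigroup_fix_nat_sum.
exact: orthant_nat_sum.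
Qed.

(** By continuity every neighbourhood of [T q z] contains some [T r z = z], so it meets every
    neighbourhood of [z]; a Hausdorff topology then identifies the two points. *)
Lemma semigroup_fix_dense (tau_hausdorff : hausdorff_space (retopo tau)) (q : 'rV[R]_n) :
  nonneg_orthant q ->
  (forall e : R, 0 < e -> exists r, [/\ nonneg_orthant r, T r z = z &
     forall i, `|q ord0 i - r ord0 i| < e]) ->
  T q z = z.
Proof.
move=> q0 dense; apply: tau_hausdorff => A B nA nB.
have /subspace_continuousP/(_ q q0) := semigroup_continuous T_sg Cz.
move=> /(_ A nA) /nbhs_ballP [e /= e0 eA].
have [r [r0 rz qr]] := dense e e0.
exists z; split; last exact: nbhs_singleton nB.
rewrite -rz; apply: eA => //.
by split=> // i j; rewrite !ord1; exact: qr.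
Qed.

End SemigroupFixedPoints.

(** [m p_0 - sum c_i p_i] has coordinates [m alpha_i - c_i] in the basis of the [p_i], and
    Kronecker's theorem brings these close to those of any target. *)
Lemma kronecker_orthant {R : realType} (n : nat) (p : 'I_n.+1 -> 'rV[R]_n)
    (alpha : n.-tuple R) (q : 'rV[R]_n) (e : R) :
  free [tuple p (lift ord0 i) | i < n] -> rat_independent [tuple of 1 :: alpha] ->
  p ord0 = \sum_(i < n) tnth alpha i *: p (lift ord0 i) ->
  nonneg_orthant q -> 0 < e ->
  exists nu : 'I_n.+1 -> int, let r := \sum_j (nu j)%:~R *: p j in
    nonneg_orthant r /\ forall i, `|q ord0 i - r ord0 i| < e.
Proof.
move=> pf indep p0E q0 e0.
set X := [tuple _ | i < n] in pf.
(* Aiming [e / 2] above [q] in each coordinate keeps the approximation in the orthant. *)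
pose q' : 'rV[R]_n := \row_i (q ord0 i + e / 2).
have spanX : <<X>>%VS = fullv.
  apply/eqP; rewrite eqEdim subvf /= dimvf /= (eqP pf) size_tuple.
  by rewrite /dim /= mul1n.
have q'E : q' = \sum_i coord X i q' *: p (lift ord0 i).
  rewrite {1}(@coord_span _ _ _ X q') ?spanX ?memvf//.
  by apply: eq_bigr => i _; rewrite (nth_map i) ?size_enum_ord// nth_ord_enum.
(* [M] bounds how far coefficient errors can move an entry of the vector; the 1 makes it
   positive. *)
pose M : R := 1 + \sum_i \sum_k `|p (lift ord0 i) ord0 k|.
have M0 : 0 < M by rewrite ltr_pwDl// sumr_ge0// => i _; rewrite sumr_ge0.
have eM : 0 < e / 2 / M by rewrite !divr_gt0.
have [|m [c mc]] := kronecker n (tnth alpha) (fun i => coord X i q') _ _ eM.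
  move=> c nu h i.
  have := indep (fun j => if unlift ord0 j is Some k then nu k else c).
  rewrite big_ord_recl unlift_none (tnth_nth 0) /= mulr1.
  have -> : \sum_(i < n) (match unlift ord0 (lift ord0 i) with Some k => nu k | None => c end)%:~R *
      tnth [tuple of 1 :: alpha] (lift ord0 i) = \sum_i (nu i)%:~R * tnth alpha i.
    by apply: eq_bigr => j _; rewrite liftK tnthS.
  by move=> /(_ h (lift ord0 i)); rewrite liftK.
exists (fun j => if unlift ord0 j is Some k then - c k else m) => r.
have rE : r = \sum_i (m%:~R * tnth alpha i - (c i)%:~R) *: p (lift ord0 i).
  rewrite /r big_ord_recl unlift_none p0E scaler_sumr -big_split; apply: eq_bigr => i _ /=.
  by rewrite liftK rmorphN /= scalerA scalerBl scaleNr.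
have rq' k : `|r ord0 k - q' ord0 k| < e / 2.
  rewrite rE q'E !summxE -sumrB (le_lt_trans (ler_norm_sum _ _ _))//.
  apply: le_lt_trans (_ : (e / 2 / M) * \sum_i `|p (lift ord0 i) ord0 k| < _).
    rewrite mulr_sumr; apply: ler_sum => i _.
    by rewrite !mxE -mulrBl normrM ler_wpM2r// ltW// mc.
  rewrite -[X in _ < X](@divfK _ M) ?gt_eqF// ltr_pM2l//.
  apply: le_lt_trans (_ : \sum_i \sum_k `|p (lift ord0 i) ord0 k| < M); last by rewrite ltrDr.
  apply: ler_sum => i _; rewrite (bigD1 k)//= lerDl; exact: sumr_ge0.
split=> [k|k]; have := rq' k; have := q0 k; rewrite /q' !mxE ltr_norml.
  by move=> ? /andP[? ?]; lra.
by move=> ? /andP[? ?]; rewrite ltr_norml; apply/andP; split; lra.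
Qed.

(** * Averages of maps *)

Lemma convex_in_sum {R : realType} {E : lmodType R} (C : set E) (m : nat)
    (lambda : 'I_m -> R) (v : 'I_m -> E) :
  convex_in C -> (forall j, 0 <= lambda j) -> \sum_j lambda j = 1 ->
  (forall j, C (v j)) -> C (\sum_j lambda j *: v j).
Proof.
move=> cC; elim: m lambda v => [|m IH] lambda v l0 l1 Cv.
  by move: l1; rewrite big_ord0 => /eqP; rewrite eq_sym oner_eq0.
move: l1; rewrite !big_ord_recl; set s := lambda ord0; set q := \sum_(i < m) _ => sq.
have q0 : 0 <= q by apply: sumr_ge0.
have [qz|qn] := eqVneq q 0.
  rewrite big1 => [|j _].
    have -> : s = 1 by lra.
    by rewrite scale1r addr0.
  suff -> : lambda (lift ord0 j) = 0 by rewrite scale0r.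
  apply/eqP; rewrite eq_le l0 andbT -qz /q (bigD1 j)//= lerDl; exact: sumr_ge0.
have -> : \sum_(i < m) lambda (lift ord0 i) *: v (lift ord0 i) =
    (1 - s) *: \sum_(i < m) (lambda (lift ord0 i) / q) *: v (lift ord0 i).
  rewrite scaler_sumr; apply: eq_bigr => j _; rewrite scalerA mulrCA.
  have -> : 1 - s = q by lra.
  by rewrite mulfV// mulr1.
apply: cC => //; last by have := l0 ord0; rewrite -/s; lra.
apply: (IH (fun i => lambda (lift ord0 i) / q)) => // [j|]; first by rewrite divr_ge0.
by rewrite -mulr_suml mulfV.
Qed.

(** The distance from the [V]-orbit to [z] converges, and [V u - z] is the midpoint of [u - z] and
    [f u - z], whose norms are at most [|u - z|]. A midpoint that loses almost no norm forces [u]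
    and [f u] together. *)
Lemma averaged_asymptotically_regular {R : realType} {E : completeNormedModType R}
    (uc : uniformly_convex E) (C : set E) (f : E -> E) (D : R) (y z : E) :
  convex_in C -> (forall x, C x -> `|x| <= D) ->
  (forall x, C x -> C (f x)) -> nonexpansive_on C f ->
  C y -> C z -> f z = z ->
  let V x := 2^-1 *: f x + (1 - 2^-1) *: x in
  [/\ forall x, C x -> C (V x), nonexpansive_on C V &
   forall eps : R, 0 < eps -> exists N, forall i, (N <= i)%N ->
    `|iter i V y - f (iter i V y)| <= eps].
Proof.
move=> cC bC fC nf Cy Cz fz V.
have VC x : C x -> C (V x) by move=> Cx; apply: cC => //; [exact: fC|lra].
have nV : nonexpansive_on C V.
  move=> a b Ca Cb; have -> : V a - V b = 2^-1 *: (f a - f b) + 2^-1 *: (a - b).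
    by rewrite /V; lmod_eq R [:: a; b; f a; f b]; field.
  rewrite (le_trans (ler_normD _ _))// !normr_scale ?invr_ge0 ?ler0n//.
  by have := nf _ _ Ca Cb; lra.
split=> // e e0.
have Vz : V z = z by rewrite /V fz; lmod_eq R [:: z]; field.
have [l lP] := asymptotic_orbit_dist C V VC nV _ _ (asymptotic_orbit_iter C V VC _ Cy)
  (asymptotic_orbit_fixed C V _ Cz Vz).
have [d d0 dP] := uniformly_convex_midpoint uc (2 * D) e e0.
have [N NP] := lP (d / 2) (divr_gt0 d0 (ltr0Sn _ _)).
exists N => i Ni; have := NP i Ni; have := NP i.+1 (leq_trans Ni (leqnSn i)).
rewrite iterS; set u := iter i V y.
have Cu : C u by exact: iter_in.
have -> : u - f u = (u - z) - (f u - z) by lmod_eq R [:: u; f u; z]; ring.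
rewrite !ler_norml => /andP[h1 _] /andP[_ h2].
apply: (dP `|u - z|) => //.
- by rewrite (le_trans (ler_normB _ _))//; have := bC _ Cu; have := bC _ Cz; lra.
- by rewrite -{1}fz; exact: nf.
- have -> : u - z + (f u - z) = 2 *: (V u - z).
    by rewrite /V; lmod_eq R [:: u; f u; z]; field.
  by rewrite normr_scale ?ler0n// ler_pM2l//; lra.
Qed.

Theorem theorem4 (R : realType) (n : nat) (n_ge1 : (1 <= n)%N)
    (E : completeNormedModType R)
    (E_uc : uniformly_convex E) (E_fd : frechet_differentiable_norm E)
    (tau : topology_on E) (tau_hausdorff : hausdorff_space (retopo tau))
    (C : set E) (C_bounded : bounded_set C) (C_closed : closed C)
    (C_convex : convex_set (C : set (convex_lmodType E)))
    (T : 'rV[R]_n -> E -> E) (T_sg : nonexpansive_semigroup tau C T)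
    (p : 'I_n.+1 -> 'rV[R]_n) (p_ge0 : forall j, nonneg_orthant (p j))
    (p_free : free [tuple p (lift ord0 i) | i < n])
    (alpha : n.-tuple R) (alpha_indep : rat_independent [tuple of 1 :: alpha])
    (p0E : p ord0 = \sum_(i < n) tnth alpha i *: p (lift ord0 i))
    (lambda : 'I_n.+1 -> R) (lambda01 : forall j, 0 < lambda j < 1)
    (lambda_sum : \sum_(j < n.+1) lambda j = 1)
    (S : E -> E)
    (SE : forall z, C z -> S z = \sum_(j < n.+1) lambda j *: T (p j) z)
    (x y1 : E) (Cx : C x) (Cy1 : C y1)
    (x_ y_ : nat -> E)
    (x_E : forall k, (1 <= k)%N ->
       x_ k = k%:R^-1 *: \sum_(1 <= i < k.+1) iter i S x)
    (y_1 : y_ 1%N = y1)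
    (y_S : forall k, (1 <= k)%N ->
       y_ k.+1 = 2^-1 *: S (y_ k) + 2^-1 *: y_ k) :
  (exists2 z, common_fixed_point C T z & weakly_cvg x_ z) /\
  (exists2 z, common_fixed_point C T z & weakly_cvg y_ z).

Proof.
have cC := convex_set_in C C_convex.
have [D bC] : exists D : R, forall z, C z -> `|z| <= D.
  by have [M [Mr MP]] := C_bounded; exists (M + 1) => z; apply: MP; rewrite ltrDl.
have TC j z : C z -> C (T (p j) z) by move=> Cz; exact: (semigroup_maps T_sg).
have Tne j : nonexpansive_on C (T (p j)) by exact: (semigroup_nonexpansive T_sg).
(* The [T (p j)] commute because addition of parameters does. [z0] serves as origin in the strict
   convexity argument and in the regularity of [V]. *)
have [z0 [Cz0 fz0]] : exists z, C z /\ forall j, T (p j) z = z.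
  apply: (commuting_fixed_point D E_uc C) => //; first by exists x.
  by move=> i j z Cz; rewrite -!(semigroupD T_sg)// addrC.
have convex_fix z : (forall j, T (p j) z = z) -> \sum_(j < n.+1) lambda j *: T (p j) z = z.
  by move=> fz; under eq_bigr do rewrite fz; rewrite -scaler_suml lambda_sum scale1r.
have SC z : C z -> C (S z).
  move=> Cz; rewrite SE//; apply: convex_in_sum => // j.
    by have /andP[/ltW] := lambda01 j.
  exact: TC.
have Sne : nonexpansive_on C S.
  move=> u v Cu Cv; rewrite !SE// -sumrB (le_trans (ler_norm_sum _ _ _))//.
  rewrite -[leRHS]mul1r -lambda_sum mulr_suml; apply: ler_sum => j _.
  have /andP[/ltW l0 _] := lambda01 j.
  by rewrite -scalerBr normr_scale// ler_wpM2l// Tne.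
(* A fixed point of [S] is fixed by each [T (p j)], then by [T] at integer combinations in the
   orthant, then by density at every [q]. *)
have Sfix z : C z -> S z = z -> common_fixed_point C T z.
  move=> Cz Sz; split=> // q q0.
  have Tz : forall j, T (p j) z = z.
    apply: (convex_combination_fixed E_uc _ lambda (fun j => T (p j)) C z z0) => //.
    by rewrite -SE.
  apply: (semigroup_fix_dense _ tau C T T_sg z Cz tau_hausdorff q q0) => e e0.
  have [nu [r0 qr]] := kronecker_orthant n p alpha q e p_free alpha_indep p0E q0 e0.
  exists (\sum_j (nu j)%:~R *: p j); split=> //.
  exact: (semigroup_fix_int_sum _ tau C T T_sg _ p z p_ge0 Cz Tz nu).
split.
  have [z [Cz Sz xz]] := means_weakly_cvg C S D E_uc E_fd SC Sne cC C_closed bC x x_ Cx x_E.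
  by exists z => //; exact: Sfix.
have [VC Vne Vreg] := averaged_asymptotically_regular E_uc C S D y1 z0 cC bC SC Sne Cy1 Cz0
  (etrans (SE _ Cz0) (convex_fix z0 fz0)).
set V := fun _ => _ in VC Vne Vreg.
(* [y_] starts at index 1, hence the shift. *)
have y_E k : y_ k.+1 = iter k V y1.
  elim: k => [//|k IH]; rewrite y_S// iterS -IH /V.
  by congr (_ + _ *: _); field.
have [||z [Cz Vz yz]] := orbit_weakly_cvg C V D E_uc E_fd VC Vne cC C_closed bC
   (fun k => iter k V y1).
- exact: asymptotic_orbit_iter.
- move=> e e0; have [N NP] := Vreg e e0; exists N => i Ni; have := NP i Ni.
  set u := iter i V y1; have -> : u - V u = 2^-1 *: (u - S u).
    by rewrite /V; lmod_eq R [:: u; S u]; field.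
  by rewrite normr_scale ?invr_ge0 ?ler0n//; have := normr_ge0 (u - S u); lra.
exists z.
  (* A fixed point of [V] is one of [S]. *)
  apply: Sfix => //; have : 2 *: (V z - z) = S z - z.
    by rewrite /V; lmod_eq R [:: z; S z]; field.
  by rewrite Vz subrr scaler0 => /esym/eqP; rewrite subr_eq0 => /eqP.
move=> h ch; rewrite -cvg_shiftS; under eq_fun do rewrite /= y_E.
exact: yz.
Qed.
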